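(* Let $\varphi:\mathbb{R}^2\to\mathbb{R}$ be a harmonic function, let $g_0$ be the standard Euclidean metric on $\mathbb{R}^2$, and let $g_\varphi=e^{2\varphi}g_0$. Then for every $p\in\mathbb{R}^2$ there exist a simply connected open neighborhood $\mathscr{V}$ of $p$ and a harmonic function $\Phi:\mathscr{V}\to\mathbb{R}$ whose gradient vanishes nowhere on $\mathscr{V}$ and which satisfies $$\Phi+\log\|\nabla\Phi\|_0=\varphi\quad\text{on }\mathscr{V},$$ such that, for any harmonic conjugate $\Psi:\mathscr{V}\to\mathbb{R}$ of $\Phi$, the map $$W:\mathscr{V}\to\mathbb{R}^2,\qquad W(x,y)=\left(e^{\Phi(x,y)}\cos\Psi(x,y),\ e^{\Phi(x,y)}\sin\Psi(x,y)\right),$$ is an isometry from $(\mathscr{V},g_\varphi|_{\mathscr{V}})$ onto its image, an open subset of $(\mathbb{R}^2,g_0)$.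
   Context: $\nabla$ is the Euclidean gradient and $\|\cdot\|_0$ is the Euclidean length (the length with respect to $g_0$). A function is harmonic if it is smooth and its standard Laplacian $\partial_x^2+\partial_y^2$ vanishes. A harmonic conjugate of $\Phi$ is a harmonic function $\Psi$ such that $\Phi+i\Psi$ is complex analytic, i.e. $\Phi_x=\Psi_y$ and $\Phi_y=-\Psi_x$. The metric $g_\varphi=e^{2\varphi}g_0$ has inner product at each point equal to $e^{2\varphi}$ times the Euclidean one. $W$ being an isometry of $(\mathscr{V},g_\varphi)$ onto its image in $(\mathbb{R}^2,g_0)$ means that $W$ is a diffeomorphism onto an open subset of $\mathbb{R}^2$ and $W^*g_0=g_\varphi$ on $\mathscr{V}$, i.e. $\langle W_*\partial_x,W_*\partial_x\rangle=\langle W_*\partial_y,W_*\partial_y\rangle=e^{2\varphi}$ and $\langle W_*\partial_x,W_*\partial_y\rangle=0$, where $\langle\cdot,\cdot\rangle$ is the Euclidean inner product. *)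

(* Defs.v *)
From Stdlib Require Import Reals.
From Coquelicot Require Import Coquelicot.
Open Scope R_scope.

(* A function or map on an open subset V of R^2 is represented by a total one whose
   values outside V are irrelevant: smoothness and derivatives at a point of V depend
   only on the germ there. *)

Definition dx (f : R * R -> R) (p : R * R) : R :=
  Derive (fun t => f (t, snd p)) (fst p).

Definition dy (f : R * R -> R) (p : R * R) : R :=
  Derive (fun t => f (fst p, t)) (snd p).

(* For V open this is C^infinity on V: [ex_diff_n] asks that all iterated partial
   derivatives up to order n exist and be jointly continuous. *)
Definition smooth_on (V : R * R -> Prop) (f : R * R -> R) : Prop :=
  forall p, V p ->
  forall n : nat, ex_diff_n (fun x y => f (x, y)) n (fst p) (snd p).

Definition smooth_map_on (V : R * R -> Prop) (F : R * R -> R * R) : Prop :=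
  smooth_on V (fun p => fst (F p)) /\ smooth_on V (fun p => snd (F p)).

Definition laplacian (f : R * R -> R) (p : R * R) : R :=
  dx (dx f) p + dy (dy f) p.

Definition harmonic_on (V : R * R -> Prop) (f : R * R -> R) : Prop :=
  smooth_on V f /\ (forall p, V p -> laplacian f p = 0).

Definition harmonic_conjugate_on (V : R * R -> Prop) (Phi Psi : R * R -> R) : Prop :=
  harmonic_on V Psi /\
  (forall p, V p -> dx Phi p = dy Psi p /\ dy Phi p = - dx Psi p).

Definition gradient (f : R * R -> R) (p : R * R) : R * R := (dx f p, dy f p).

(* A metric takes a base point and two tangent vectors at that point. *)
Definition metric : Type := R * R -> R * R -> R * R -> R.

Definition g0 : metric := fun _ u v => fst u * fst v + snd u * snd v.

Definition conformal_metric (phi : R * R -> R) : metric :=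
  fun p u v => exp (2 * phi p) * g0 p u v.

Definition metric_length (g : metric) (p v : R * R) : R := sqrt (g p v v).

Definition pushforward (F : R * R -> R * R) (p v : R * R) : R * R :=
  (dx (fun q => fst (F q)) p * fst v + dy (fun q => fst (F q)) p * snd v,
   dx (fun q => snd (F q)) p * fst v + dy (fun q => snd (F q)) p * snd v).

Definition pullback_metric (F : R * R -> R * R) (h : metric) : metric :=
  fun p u v => h (F p) (pushforward F p u) (pushforward F p v).

Definition image (F : R * R -> R * R) (V : R * R -> Prop) : R * R -> Prop :=
  fun q => exists p, V p /\ F p = q.

Definition diffeomorphism (V U : R * R -> Prop) (F : R * R -> R * R) : Prop :=
  smooth_map_on V F /\ (forall p, V p -> U (F p)) /\
  exists G : R * R -> R * R,
    smooth_map_on U G /\ (forall q, U q -> V (G q)) /\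
    (forall p, V p -> G (F p) = p) /\ (forall q, U q -> F (G q) = q).

Definition isometry (V : R * R -> Prop) (g : metric)
    (U : R * R -> Prop) (h : metric) (F : R * R -> R * R) : Prop :=
  diffeomorphism V U F /\
  (forall p, V p -> forall u v, pullback_metric F h p u v = g p u v).

Definition unit_interval (t : R) : Prop := 0 <= t <= 1.

Definition unit_square (s : R * R) : Prop :=
  unit_interval (fst s) /\ unit_interval (snd s).

Definition path_in (V : R * R -> Prop) (gamma : R -> R * R) : Prop :=
  continuous_on unit_interval gamma /\ (forall t, unit_interval t -> V (gamma t)).

Definition path_connected (V : R * R -> Prop) : Prop :=
  forall p q, V p -> V q ->
  exists gamma, path_in V gamma /\ gamma 0 = p /\ gamma 1 = q.

(* [H (s, t)]: s is the deformation parameter, t the loop parameter. *)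
Definition null_homotopic_in (V : R * R -> Prop) (gamma : R -> R * R) : Prop :=
  exists H : R * R -> R * R,
    continuous_on unit_square H /\
    (forall z, unit_square z -> V (H z)) /\
    (forall t, unit_interval t -> H (0, t) = gamma t /\ H (1, t) = gamma 0) /\
    (forall s, unit_interval s -> H (s, 0) = gamma 0 /\ H (s, 1) = gamma 0).

Definition simply_connected (V : R * R -> Prop) : Prop :=
  path_connected V /\
  (forall gamma, path_in V gamma -> gamma 0 = gamma 1 -> null_homotopic_in V gamma).

(* Main.v *)
(** In complex notation: if [psi] is a harmonic conjugate of [phi], then
    [u + i v = exp (phi + i psi)] is holomorphic without zeros; let [a + i b] be its
    primitive with value 1 at [p]. Near [p] take [Phi = ln |a + i b|]. Then
    [|grad Phi| = |u + i v| / |a + i b| = exp (phi - Phi)], which is the required equation.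
    For any harmonic conjugate [Psi] of [Phi], [W = exp (Phi + i Psi)] and [a + i b] have the
    same logarithmic derivative, so [W] is a constant rotation of [a + i b] and [|W'| = exp phi].
    On a small box around [p], which does not depend on [Psi], [a + i b] is a perturbation of a
    scaling and hence an open embedding by the contraction principle. *)

Require Import Defs.
From Stdlib Require Import Reals Lra Lia ClassicalEpsilon.
From Coquelicot Require Import Coquelicot.
Open Scope R_scope.

(** * Functions of class C^n *)

(** A complex function is carried as a pair of real functions with explicit partials in
    Cauchy-Riemann form, so facts about holomorphic functions become real identities closed by
    [ring] or [field]. Both primitives, [psi] and [a + i b], come from closed 1-forms on the whole
    plane. The normalisations at [p] shape the estimates. Taking [psi] zero at [p] makes the
    derivative of [a + i b] there the positive real number [c = u p], so the nearby comparison is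
    with a pure scaling and no matrix has to be inverted. The value 1 of the primitive keeps [a]
    positive nearby, so that the logarithm of the modulus is defined. The main constraint is that
    the neighbourhood is chosen before [Psi] is given: every estimate is made for [a + i b] and
    carried to [W] by the rotation, at the price of a factor 2, since coordinatewise norms are not
    rotation invariant. The contraction yields only openness and a Lipschitz inverse. Smoothness of
    the inverse is bootstrapped from the formula for its derivative, the reciprocal of [W'] composed
    with the inverse itself. *)

Definition Ck (V : R * R -> Prop) (n : nat) (f : R * R -> R) : Prop :=
  forall q, V q -> ex_diff_n (fun x y => f (x, y)) n (fst q) (snd q).

(** The partials are named functions instead of [dx f] and [dy f], so formulas can be combined
    algebraically; the passage to [Derive] is made once, by uniqueness. *)
Definition has_partials (V : R * R -> Prop) (f fx fy : R * R -> R) : Prop :=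
  forall q, V q ->
    is_derive (fun t => f (t, snd q)) (fst q) (fx q) /\
    is_derive (fun t => f (fst q, t)) (snd q) (fy q).

Lemma continuous_continuity_2d (f : R * R -> R) (q : R * R) :
  continuous f q <-> continuity_2d_pt (fun x y => f (x, y)) (fst q) (snd q).
Proof.
  destruct q as [x y]; simpl. rewrite continuity_2d_pt_filterlim.
  split; apply filterlim_ext; now intros [u v].
Qed.

Lemma locally_locally_2d (P : R * R -> Prop) (q : R * R) :
  locally q P <-> locally_2d (fun x y => P (x, y)) (fst q) (snd q).
Proof.
  destruct q as [x y]; simpl; rewrite locally_2d_locally.
  split; apply filter_imp; now intros [u v].
Qed.

Lemma open_slices (V : R * R -> Prop) (q : R * R) : open V -> V q ->
  locally (fst q) (fun t => V (t, snd q)) /\ locally (snd q) (fun t => V (fst q, t)).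
Proof.
  intros HV Hq. destruct q as [x y]; simpl.
  assert (H := HV _ Hq). apply locally_locally_2d in H; simpl in H.
  split; [apply (locally_2d_1d_const_y _ _ _ H) | apply (locally_2d_1d_const_x _ _ _ H)].
Qed.

Lemma has_partials_unique (V : R * R -> Prop) (f fx fy : R * R -> R) :
  has_partials V f fx fy -> forall q, V q -> dx f q = fx q /\ dy f q = fy q.
Proof.
  intros H q Hq. destruct (H q Hq). split; now apply is_derive_unique.
Qed.

Lemma has_partials_ext (V : R * R -> Prop) (f g fx fy gx gy : R * R -> R) :
  open V -> (forall q, V q -> f q = g q) ->
  (forall q, V q -> fx q = gx q) -> (forall q, V q -> fy q = gy q) ->
  has_partials V f fx fy -> has_partials V g gx gy.
Proof.
  intros HV E Ex Ey H q Hq. destruct (open_slices V q HV Hq) as [S1 S2].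
  destruct (H q Hq). rewrite <- Ex, <- Ey by trivial. split.
  - eapply is_derive_ext_loc; [| eassumption]. revert S1; apply filter_imp; auto.
  - eapply is_derive_ext_loc; [| eassumption]. revert S2; apply filter_imp; auto.
Qed.

Lemma has_partials_subset (V U : R * R -> Prop) (f fx fy : R * R -> R) :
  (forall q, V q -> U q) -> has_partials U f fx fy -> has_partials V f fx fy.
Proof. intros S H q Hq; auto. Qed.

Lemma Ck_ext (V : R * R -> Prop) (n : nat) (f g : R * R -> R) :
  open V -> (forall q, V q -> f q = g q) -> Ck V n f -> Ck V n g.
Proof.
  intros HV E H q Hq. apply ex_diff_n_ext_loc with (2 := H q Hq).
  apply (locally_locally_2d (fun z => f z = g z)).
  generalize (HV q Hq). apply filter_imp; auto.
Qed.

Lemma Ck_continuous (V : R * R -> Prop) (n : nat) (f : R * R -> R) :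
  Ck V n f -> forall q, V q -> continuous f q.
Proof.
  intros H q Hq. apply continuous_continuity_2d. specialize (H q Hq).
  destruct n; exact (proj1 H).
Qed.

Lemma Ck_0 (V : R * R -> Prop) (f : R * R -> R) :
  (forall q, V q -> continuous f q) -> Ck V 0 f.
Proof.
  intros H q Hq. split; [|exact I]. now apply continuous_continuity_2d, H.
Qed.

Lemma Ck_le (V : R * R -> Prop) (m n : nat) (f : R * R -> R) :
  (m <= n)%nat -> Ck V n f -> Ck V m f.
Proof. intros L H q Hq. now apply ex_diff_n_m with n; auto. Qed.

Lemma Ck_S_inv (V : R * R -> Prop) (n : nat) (f : R * R -> R) : Ck V (S n) f ->
  has_partials V f (dx f) (dy f) /\ Ck V n (dx f) /\ Ck V n (dy f).
Proof.
  intros H; split; [|split]; intros q Hq; destruct (H q Hq) as (_ & E1 & E2 & D1 & D2); auto.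
  split; now apply Derive_correct.
Qed.

(** The x-partial is used on a whole neighbourhood and the y-partial at [q] alone, whence the
    asymmetric continuity hypothesis. *)
Lemma has_partials_differentiable (V : R * R -> Prop) (f fx fy : R * R -> R) (q : R * R) :
  open V -> has_partials V f fx fy -> V q -> continuous fx q ->
  differentiable_pt_lim (fun x y => f (x, y)) (fst q) (snd q) (fx q) (fy q).
Proof.
  intros HV H Hq C. destruct q as [x y]; simpl.
  apply filterdiff_differentiable_pt_lim.
  apply (is_derive_filterdiff (fun x y => f (x, y)) x y (fun x y => fx (x, y)) (fy (x, y))).
  - generalize (HV _ Hq). apply filter_imp. intros [u v] Hu. apply (H _ Hu).
  - apply (H _ Hq).
  - revert C. apply filterlim_ext. now intros [u v].
Qed.

Lemma has_partials_continuous (V : R * R -> Prop) (f fx fy : R * R -> R) (q : R * R) :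
  open V -> has_partials V f fx fy -> V q -> continuous fx q -> continuous f q.
Proof.
  intros HV H Hq C. apply continuous_continuity_2d, differentiable_continuity_pt.
  exists (fx q), (fy q). now apply has_partials_differentiable with V.
Qed.

(** The induction step of all regularity proofs below: each calculus rule is first stated for
    [has_partials], and its formula for the partials is then fed in here. *)
Lemma Ck_S (V : R * R -> Prop) (n : nat) (f fx fy : R * R -> R) : open V ->
  has_partials V f fx fy -> Ck V n fx -> Ck V n fy -> Ck V (S n) f.
Proof.
  intros HV H Cx Cy q Hq. split; [|split; [|split; [|split]]].
  - apply continuous_continuity_2d. apply (has_partials_continuous V f fx fy); auto.
    now apply (Ck_continuous V n).
  - eexists; apply (H q Hq).
  - eexists; apply (H q Hq).
  - apply (Ck_ext V n fx (dx f)); auto. intros z Hz. symmetry. now apply (has_partials_unique V f fx fy).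
  - apply (Ck_ext V n fy (dy f)); auto. intros z Hz. symmetry. now apply (has_partials_unique V f fx fy).
Qed.

Lemma Ck_partials (V : R * R -> Prop) (n : nat) (f fx fy : R * R -> R) : open V ->
  has_partials V f fx fy -> Ck V n fx -> Ck V n fy -> Ck V n f.
Proof. intros. apply Ck_le with (S n); [lia | now apply Ck_S with fx fy]. Qed.

(** * Calculus rules for partial derivatives and the classes C^n *)

Lemma has_partials_const (V : R * R -> Prop) (c : R) :
  has_partials V (fun _ => c) (fun _ => 0) (fun _ => 0).
Proof. intros q Hq; split; apply (is_derive_const c). Qed.

Lemma has_partials_plus (V : R * R -> Prop) (f fx fy g gx gy : R * R -> R) :
  has_partials V f fx fy -> has_partials V g gx gy ->
  has_partials V (fun q => f q + g q) (fun q => fx q + gx q) (fun q => fy q + gy q).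
Proof.
  intros Hf Hg q Hq. destruct (Hf q Hq), (Hg q Hq).
  split; apply @is_derive_plus; assumption.
Qed.

Lemma has_partials_opp (V : R * R -> Prop) (f fx fy : R * R -> R) :
  has_partials V f fx fy ->
  has_partials V (fun q => - f q) (fun q => - fx q) (fun q => - fy q).
Proof.
  intros Hf q Hq. destruct (Hf q Hq). split; apply @is_derive_opp; assumption.
Qed.

Lemma has_partials_mult (V : R * R -> Prop) (f fx fy g gx gy : R * R -> R) :
  has_partials V f fx fy -> has_partials V g gx gy ->
  has_partials V (fun q => f q * g q) (fun q => fx q * g q + f q * gx q)
    (fun q => fy q * g q + f q * gy q).
Proof.
  intros Hf Hg q Hq. destruct (Hf q Hq), (Hg q Hq). destruct q as [x y]; simpl in *.
  split.
  - apply (is_derive_mult (fun t => f (t, y)) (fun t => g (t, y)));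
      trivial; exact Rmult_comm.
  - apply (is_derive_mult (fun t => f (x, t)) (fun t => g (x, t)));
      trivial; exact Rmult_comm.
Qed.

Lemma has_partials_comp (V : R * R -> Prop) (h h' : R -> R) (f fx fy : R * R -> R) :
  (forall q, V q -> is_derive h (f q) (h' (f q))) -> has_partials V f fx fy ->
  has_partials V (fun q => h (f q)) (fun q => fx q * h' (f q)) (fun q => fy q * h' (f q)).
Proof.
  intros Hh Hf q Hq. destruct (Hf q Hq). specialize (Hh q Hq). destruct q as [x y]; simpl in *.
  split.
  - apply (is_derive_comp h (fun t => f (t, y))); trivial.
  - apply (is_derive_comp h (fun t => f (x, t))); trivial.
Qed.

Lemma has_partials_inv (V : R * R -> Prop) (f fx fy : R * R -> R) :
  (forall q, V q -> f q <> 0) -> has_partials V f fx fy ->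
  has_partials V (fun q => / f q) (fun q => fx q * - (/ f q * / f q))
     (fun q => fy q * - (/ f q * / f q)).
Proof.
  intros N H. apply (has_partials_comp V Rinv (fun t => - (/ t * / t))); trivial.
  intros q Hq. specialize (N q Hq). auto_derive; trivial. now field.
Qed.

Lemma Ck_const (V : R * R -> Prop) (n : nat) (c : R) : open V -> Ck V n (fun _ => c).
Proof.
  intros HV. revert c; induction n; intros c.
  - apply Ck_0. intros. apply continuous_const.
  - apply (Ck_S V n _ (fun _ => 0) (fun _ => 0)); auto. apply has_partials_const.
Qed.

Lemma Ck_plus (V : R * R -> Prop) (n : nat) (f g : R * R -> R) : open V ->
  Ck V n f -> Ck V n g -> Ck V n (fun q => f q + g q).
Proof.
  intros HV. revert f g; induction n; intros f g Hf Hg.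
  - apply Ck_0. intros q Hq. apply (continuous_plus f g); eapply Ck_continuous; eauto.
  - destruct (Ck_S_inv _ _ _ Hf) as (? & ? & ?), (Ck_S_inv _ _ _ Hg) as (? & ? & ?).
    eapply Ck_S; trivial.
    + apply has_partials_plus; eassumption.
    + now apply IHn.
    + now apply IHn.
Qed.

Lemma Ck_mult (V : R * R -> Prop) (n : nat) (f g : R * R -> R) : open V ->
  Ck V n f -> Ck V n g -> Ck V n (fun q => f q * g q).
Proof.
  intros HV. revert f g; induction n; intros f g Hf Hg.
  - apply Ck_0. intros q Hq. apply (continuous_mult f g); eapply Ck_continuous; eauto.
  - destruct (Ck_S_inv _ _ _ Hf) as (? & ? & ?), (Ck_S_inv _ _ _ Hg) as (? & ? & ?).
    assert (Ck V n f /\ Ck V n g) as [] by (split; apply Ck_le with (S n); auto with arith).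
    eapply Ck_S; trivial.
    + apply has_partials_mult; eassumption.
    + apply Ck_plus; auto.
    + apply Ck_plus; auto.
Qed.

Lemma Ck_opp (V : R * R -> Prop) (n : nat) (f : R * R -> R) : open V ->
  Ck V n f -> Ck V n (fun q => - f q).
Proof.
  intros HV Hf. apply Ck_ext with (fun q => -1 * f q); trivial.
  - intros; ring.
  - apply Ck_mult; trivial. now apply Ck_const.
Qed.

Lemma Ck_minus (V : R * R -> Prop) (n : nat) (f g : R * R -> R) : open V ->
  Ck V n f -> Ck V n g -> Ck V n (fun q => f q - g q).
Proof. intros. apply Ck_plus; trivial. now apply Ck_opp. Qed.

(** The induction keeps [f] fixed: the partials of [1 / f] contain [1 / f] itself, which is of class
    C^n by the induction hypothesis. *)
Lemma Ck_inv (V : R * R -> Prop) (n : nat) (f : R * R -> R) : open V ->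
  (forall q, V q -> f q <> 0) -> Ck V n f -> Ck V n (fun q => / f q).
Proof.
  intros HV N. induction n; intros Hf.
  - apply Ck_0. intros q Hq. apply (continuous_comp f Rinv).
    + eapply Ck_continuous; eauto.
    + now apply continuous_Rinv, N.
  - destruct (Ck_S_inv _ _ _ Hf) as (? & ? & ?).
    assert (Ck V n (fun q => / f q)) by (apply IHn, Ck_le with (S n); auto with arith).
    eapply Ck_S; trivial.
    + apply has_partials_inv; eassumption.
    + apply Ck_mult; trivial. apply Ck_opp; trivial. now apply Ck_mult.
    + apply Ck_mult; trivial. apply Ck_opp; trivial. now apply Ck_mult.
Qed.

(** * The chain rule in two variables *)

Lemma is_derive_comp_2d (f : R * R -> R) (g h : R -> R) (t lx ly l1 l2 : R) :
  differentiable_pt_lim (fun x y => f (x, y)) (g t) (h t) lx ly ->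
  is_derive g t l1 -> is_derive h t l2 ->
  is_derive (fun s => f (g s, h s)) t (lx * l1 + ly * l2).
Proof.
  intros D Hg Hh. apply is_derive_Reals. apply (derivable_pt_lim_comp_2d (fun x y => f (x, y)));
   trivial; now apply is_derive_Reals.
Qed.

Lemma has_partials_comp_2d (U V : R * R -> Prop)
    (f fx fy g gx gy h hx hy : R * R -> R) :
  open U -> has_partials U f fx fy -> (forall z, U z -> continuous fx z) ->
  (forall q, V q -> U (g q, h q)) ->
  has_partials V g gx gy -> has_partials V h hx hy ->
  has_partials V (fun q => f (g q, h q))
    (fun q => fx (g q, h q) * gx q + fy (g q, h q) * hx q)
    (fun q => fx (g q, h q) * gy q + fy (g q, h q) * hy q).
Proof.
  intros HU Hf Cf S Hg Hh q Hq. specialize (S q Hq).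
  assert (D := has_partials_differentiable U f fx fy _ HU Hf S (Cf _ S)); simpl in D.
  destruct (Hg q Hq), (Hh q Hq). destruct q as [x y]; simpl in *.
  split.
  - now apply (is_derive_comp_2d f (fun t => g (t, y)) (fun t => h (t, y))).
  - now apply (is_derive_comp_2d f (fun t => g (x, t)) (fun t => h (x, t))).
Qed.

Lemma filterlim_locally_pair {T : Type} {U V : UniformSpace} (F : (T -> Prop) -> Prop)
    {FF : Filter F} (f : T -> U) (g : T -> V) (l : U) (m : V) :
  filterlim f F (locally l) -> filterlim g F (locally m) ->
  filterlim (fun z => (f z, g z)) F (locally (l, m)).
Proof.
  intros Cf Cg. apply (filterlim_comp_2 f g (fun a b => (a, b)) Cf Cg).
  intros P [eps H].
  apply Filter_prod with (ball l eps) (ball m eps).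
  - apply locally_ball.
  - apply locally_ball.
  - intros u v Hu Hv. apply H. now split.
Qed.

(** Only the outer function varies in the induction: differentiating replaces [f] by its partials,
    composed with the same [g] and [h]. *)
Lemma Ck_comp_2d (U V : R * R -> Prop) (n : nat) (f g h : R * R -> R) :
  open U -> open V -> (forall q, V q -> U (g q, h q)) ->
  Ck U n f -> Ck V n g -> Ck V n h -> Ck V n (fun q => f (g q, h q)).
Proof.
  intros HU HV HS. revert f. induction n; intros f Hf Hg Hh.
  - apply Ck_0. intros q Hq. apply (continuous_comp (fun z => (g z, h z)) f).
    + apply (filterlim_locally_pair (locally q)); eapply Ck_continuous; eauto.
    + eapply Ck_continuous; eauto.
  - destruct (Ck_S_inv _ _ _ Hf) as (? & ? & ?), (Ck_S_inv _ _ _ Hg) as (? & ? & ?),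
      (Ck_S_inv _ _ _ Hh) as (? & ? & ?).
    assert (Ck V n g /\ Ck V n h) as [] by (split; apply Ck_le with (S n); auto with arith).
    eapply Ck_S; trivial.
    + eapply has_partials_comp_2d with (U := U); try eassumption.
      now apply (Ck_continuous U n).
    + apply Ck_plus; trivial; apply Ck_mult; auto.
    + apply Ck_plus; trivial; apply Ck_mult; auto.
Qed.

(** * Polar form and exact 1-forms *)

(** The hypotheses say that [f + i g] is holomorphic with derivative [P - i Q]; the formulas are the
    real and imaginary parts of [exp (f + i g) (P - i Q)]. *)
Lemma has_partials_polar (V : R * R -> Prop) (f g P Q : R * R -> R) :
  has_partials V f P Q -> has_partials V g (fun q => - Q q) P ->
  has_partials V (fun q => exp (f q) * cos (g q))
    (fun q => exp (f q) * cos (g q) * P q + exp (f q) * sin (g q) * Q q)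
    (fun q => exp (f q) * cos (g q) * Q q - exp (f q) * sin (g q) * P q) /\
  has_partials V (fun q => exp (f q) * sin (g q))
    (fun q => exp (f q) * sin (g q) * P q - exp (f q) * cos (g q) * Q q)
    (fun q => exp (f q) * sin (g q) * Q q + exp (f q) * cos (g q) * P q).
Proof.
  intros Hf Hg.
  assert (He : has_partials V (fun q => exp (f q)) (fun q => P q * exp (f q))
                 (fun q => Q q * exp (f q))).
  { apply (has_partials_comp V exp exp); trivial. intros; apply is_derive_exp. }
  assert (Hc : has_partials V (fun q => cos (g q)) (fun q => - Q q * - sin (g q))
                 (fun q => P q * - sin (g q))).
  { apply (has_partials_comp V cos (fun t => - sin t) g (fun q => - Q q)); trivial.
    intros; apply is_derive_cos. }
  assert (Hs : has_partials V (fun q => sin (g q)) (fun q => - Q q * cos (g q))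
                 (fun q => P q * cos (g q))).
  { apply (has_partials_comp V sin cos g (fun q => - Q q)); trivial.
    intros; apply is_derive_sin. }
  split; intros q Hq.
  - destruct (has_partials_mult _ _ _ _ _ _ _ He Hc q Hq) as [H1 H2].
    split; [evar_last; [exact H1 |] | evar_last; [exact H2 |]]; simpl; ring.
  - destruct (has_partials_mult _ _ _ _ _ _ _ He Hs q Hq) as [H1 H2].
    split; [evar_last; [exact H1 |] | evar_last; [exact H2 |]]; simpl; ring.
Qed.

(** The cosine and sine parts occur in each other's partials, so they gain regularity together, one
    order at a time. *)
Lemma Ck_polar (V : R * R -> Prop) (n : nat) (f g P Q : R * R -> R) : open V ->
  has_partials V f P Q -> has_partials V g (fun q => - Q q) P ->
  Ck V n P -> Ck V n Q ->
  Ck V n (fun q => exp (f q) * cos (g q)) /\ Ck V n (fun q => exp (f q) * sin (g q)).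
Proof.
  intros HV Hf Hg. destruct (has_partials_polar V f g P Q Hf Hg) as [H1 H2].
  induction n; intros CP CQ.
  - assert (Cf : forall q, V q -> continuous f q).
    { intros q Hq. apply (has_partials_continuous V f P Q); trivial.
      now apply (Ck_continuous V 0). }
    assert (Cg : forall q, V q -> continuous g q).
    { intros q Hq. apply (has_partials_continuous V g (fun q => - Q q) P); trivial.
      apply (Ck_continuous V 0); trivial. now apply Ck_opp. }
    split; apply Ck_0; intros q Hq;
      apply @continuous_mult.
    + apply continuous_comp; [auto | apply continuous_exp].
    + apply continuous_comp; [auto | apply continuous_cos].
    + apply continuous_comp; [auto | apply continuous_exp].
    + apply continuous_comp; [auto | apply continuous_sin].
  - destruct IHn as [C1 C2]; [apply Ck_le with (S n); auto with arith .. |].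
    assert (Ck V n P /\ Ck V n Q) as [] by (split; apply Ck_le with (S n); auto with arith).
    split; (eapply Ck_S; [trivial | eassumption | |]);
     first [apply Ck_minus | apply Ck_plus]; trivial; now apply Ck_mult.
Qed.

Lemma continuous_slices (f : R * R -> R) (x y : R) : continuous f (x, y) ->
  continuous (fun t => f (t, y)) x /\ continuous (fun t => f (x, t)) y.
Proof.
  intros C. assert (C' : continuous (fun z : R * R => f (fst z, snd z)) (x, y))
    by (revert C; apply filterlim_ext; now intros [u v]).
  split.
  - apply (continuous_comp_2 (fun t : R => t) (fun _ => y) (fun a b => f (a, b)));
      [apply continuous_id | apply continuous_const | exact C'].
  - apply (continuous_comp_2 (fun _ : R => x) (fun t => t) (fun a b => f (a, b)));
      [apply continuous_const | apply continuous_id | exact C'].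
Qed.

(** The potential integrates the form along an L-shaped path, horizontal then vertical. Its
    y-partial is immediate. For the x-partial, differentiation under the integral gives the integral
    of [Qx = Py] over the vertical leg, which is [P (x, y) - P (x, py)], and the horizontal leg
    supplies the missing [P (x, py)]. *)
Lemma closed_form_exact (P Px Py Q Qx Qy : R * R -> R) (p : R * R) (c : R) :
  has_partials (fun _ => True) P Px Py -> has_partials (fun _ => True) Q Qx Qy ->
  (forall q, Py q = Qx q) ->
  (forall q, continuous P q) -> (forall q, continuous Q q) -> (forall q, continuous Qx q) ->
  exists f, f p = c /\ has_partials (fun _ => True) f P Q.
Proof.
  intros HP HQ E CP CQ CQx. destruct p as [px py].
  assert (IP : forall y a b, ex_RInt (fun t => P (t, y)) a b).
  { intros y a b. apply @ex_RInt_continuous. intros. now apply (continuous_slices P). }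
  assert (IQ : forall x a b, ex_RInt (fun t => Q (x, t)) a b).
  { intros x a b. apply @ex_RInt_continuous. intros. now apply (continuous_slices Q). }
  exists (fun q => c + (RInt (fun t => P (t, py)) px (fst q) + RInt (fun t => Q (fst q, t)) py (snd q))).
  split.
  - simpl. rewrite !RInt_point. unfold zero; simpl. ring.
  - intros [x y] _; simpl. split.
    + assert (D1 : is_derive (fun s => RInt (fun t => P (t, py)) px s) x (P (x, py))).
      { apply (is_derive_RInt (fun t => P (t, py)) _ px).
        - apply filter_forall. intros s. apply @RInt_correct, IP.
        - now apply (continuous_slices P). }
      assert (D2 : is_derive (fun s => RInt (fun t => Q (s, t)) py y) x
                    (RInt (fun t => Derive (fun u => Q (u, t)) x) py y)).
      { apply (is_derive_RInt_param (fun s t => Q (s, t))).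
        - apply filter_forall. intros s t _. eexists. apply (HQ (s, t) I).
        - intros t _. apply continuity_2d_pt_ext with (fun u v => Qx (u, v)).
          + intros u v. symmetry. apply is_derive_unique. apply (HQ (u, v) I).
          + now apply (continuous_continuity_2d Qx (x, t)).
        - apply filter_forall. intros s. apply IQ. }
      assert (D3 : RInt (fun t => Derive (fun u => Q (u, t)) x) py y = P (x, y) - P (x, py)).
      { apply is_RInt_unique.
        apply is_RInt_ext with (fun t => Py (x, t)).
        - intros t _. rewrite E. symmetry. apply is_derive_unique. apply (HQ (x, t) I).
        - apply (is_RInt_derive (fun t => P (x, t))).
          + intros t _. apply (HP (x, t) I).
          + intros t _. apply continuous_ext with (fun t => Qx (x, t)).
            * intros; now rewrite E.
            * now apply (continuous_slices Qx). }
      rewrite D3 in D2.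
      evar_last.
      * apply @is_derive_plus; [apply is_derive_const | apply @is_derive_plus; eassumption].
      * unfold plus, zero; simpl. ring.
    + evar_last.
      * apply @is_derive_plus; [apply is_derive_const | apply @is_derive_plus; [apply is_derive_const |]].
        apply (is_derive_RInt (fun t => Q (x, t)) _ py).
        -- apply filter_forall. intros s. apply @RInt_correct, IQ.
        -- now apply (continuous_slices Q).
      * unfold plus, zero; simpl. ring.
Qed.

(** * Local inversion *)

(** The l1 distance matches coordinatewise estimates: mean value bounds along two axis-parallel
    segments simply add up. *)
Definition dist1 (z w : R * R) : R := Rabs (fst w - fst z) + Rabs (snd w - snd z).

Lemma ball_box (p : R * R) (d : R) (q : R * R) :
  ball p d q <-> Rabs (fst q - fst p) < d /\ Rabs (snd q - snd p) < d.
Proof. reflexivity. Qed.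

Lemma open_ball_prod (p : R * R) (d : R) : open (fun q : R * R => ball p d q).
Proof.
  destruct p as [px py]. intros [x y] Hq. apply (proj1 (ball_box _ _ _)) in Hq. simpl in Hq.
  destruct Hq as [H1 H2].
  set (e := Rmin (d - Rabs (x - px)) (d - Rabs (y - py))).
  assert (He : 0 < e) by (apply Rmin_pos; lra).
  assert (M1 : e <= d - Rabs (x - px)) by apply Rmin_l.
  assert (M2 : e <= d - Rabs (y - py)) by apply Rmin_r.
  exists (mkposreal e He). intros [u v] Hz. apply (proj1 (ball_box _ _ _)) in Hz. simpl in Hz.
  apply (proj2 (ball_box _ _ _)); simpl. destruct Hz as [Z1 Z2]. split.
  - replace (u - px) with ((u - x) + (x - px)) by ring.
    eapply Rle_lt_trans; [apply Rabs_triang | lra].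
  - replace (v - py) with ((v - y) + (y - py)) by ring.
    eapply Rle_lt_trans; [apply Rabs_triang | lra].
Qed.

Lemma derive_bound (f f' : R -> R) (a b M : R) :
  (forall t, Rmin a b <= t <= Rmax a b -> is_derive f t (f' t) /\ Rabs (f' t) <= M) ->
  Rabs (f b - f a) <= M * Rabs (b - a).
Proof.
  intros H. destruct (MVT_gen f a b f') as (c & Hc & E).
  - intros t Ht. apply H; lra.
  - intros t Ht. apply continuity_pt_filterlim.
    apply @ex_derive_continuous. eexists; now apply H.
  - rewrite E, Rabs_mult. apply Rmult_le_compat_r; [apply Rabs_pos | now apply H].
Qed.

Lemma between_ball (x d a b t : R) : Rabs (a - x) < d -> Rabs (b - x) < d ->
  Rmin a b <= t <= Rmax a b -> Rabs (t - x) < d.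
Proof.
  intros Ha Hb. apply Rabs_lt_between' in Ha. apply Rabs_lt_between' in Hb.
  intros Ht. apply Rabs_lt_between'. revert Ht.
  unfold Rmin, Rmax; destruct (Rle_dec a b); lra.
Qed.

(** The points are joined through the corner [(x', y)], which stays in the box, so the one-variable
    mean value theorem suffices on each leg. *)
Lemma box_mean_value (p : R * R) (d M : R) (f fx fy : R * R -> R) :
  has_partials (ball p d) f fx fy ->
  (forall q, ball p d q -> Rabs (fx q) <= M /\ Rabs (fy q) <= M) ->
  forall z w, ball p d z -> ball p d w -> Rabs (f w - f z) <= M * dist1 z w.
Proof.
  intros H B [x y] [x' y'] Hz Hw. apply (proj1 (ball_box _ _ _)) in Hz. apply (proj1 (ball_box _ _ _)) in Hw. unfold dist1; simpl in *.
  destruct Hz as [Hz1 Hz2], Hw as [Hw1 Hw2].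
  assert (H1 : Rabs (f (x', y) - f (x, y)) <= M * Rabs (x' - x)).
  { apply (derive_bound (fun t => f (t, y)) (fun t => fx (t, y))). intros t Ht.
    assert (Q : ball p d (t, y)) by (apply (proj2 (ball_box _ _ _)); split; trivial; now apply between_ball with x x').
    split; [apply (H _ Q) | apply (B _ Q)]. }
  assert (H2' : Rabs (f (x', y') - f (x', y)) <= M * Rabs (y' - y)).
  { apply (derive_bound (fun t => f (x', t)) (fun t => fy (x', t))). intros t Ht.
    assert (Q : ball p d (x', t)) by (apply (proj2 (ball_box _ _ _)); split; trivial; now apply between_ball with y y').
    split; [apply (H _ Q) | apply (B _ Q)]. }
  replace (f (x', y') - f (x, y)) with ((f (x', y') - f (x', y)) + (f (x', y) - f (x, y))) by ring.
  eapply Rle_trans; [apply Rabs_triang | lra].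
Qed.

Lemma box_constant (p : R * R) (d : R) (f fx fy : R * R -> R) :
  has_partials (ball p d) f fx fy -> (forall q, ball p d q -> fx q = 0 /\ fy q = 0) ->
  forall z w, ball p d z -> ball p d w -> f w = f z.
Proof.
  intros H E z w Hz Hw.
  assert (B := box_mean_value p d 0 f fx fy H).
  assert (Rabs (f w - f z) <= 0 * dist1 z w).
  { apply B; trivial. intros q Hq. destruct (E q Hq) as [-> ->]. rewrite Rabs_R0; lra. }
  rewrite Rmult_0_l in H0. assert (K := Rabs_pos (f w - f z)).
  destruct (Req_dec (f w - f z) 0); [lra |]. apply Rabs_pos_lt in H1. lra.
Qed.

(* Makes [z - ((a + i b) z - w) / c] a contraction of ratio 1/2 for [dist1], for every [w]. *)
Definition near_scaling (V : R * R -> Prop) (a b : R * R -> R) (c : R) : Prop :=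
  forall z w, V z -> V w ->
    Rabs (a w - a z - c * (fst w - fst z)) + Rabs (b w - b z - c * (snd w - snd z))
      <= c / 2 * dist1 z w.

(** Reverse triangle inequality: the scaling stretches by [c] and the error consumes at most half of
    it. This gives injectivity and a Lipschitz inverse. *)
Lemma near_scaling_lower_lipschitz (V : R * R -> Prop) (a b : R * R -> R) (c : R) :
  near_scaling V a b c -> forall z w, V z -> V w ->
  c / 2 * dist1 z w <= Rabs (a w - a z) + Rabs (b w - b z).
Proof.
  intros H z w Hz Hw. specialize (H z w Hz Hw). unfold dist1 in *.
  set (s := a w - a z) in *. set (t := b w - b z) in *.
  set (x := fst w - fst z) in *. set (y := snd w - snd z) in *.
  assert (c * Rabs x <= Rabs s + Rabs (s - c * x)).
  { eapply Rle_trans with (Rabs (c * x)).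
    - rewrite Rabs_mult. apply Rmult_le_compat_r; [apply Rabs_pos | apply Rle_abs].
    - replace (c * x) with (s + - (s - c * x)) at 1 by ring.
      eapply Rle_trans; [apply Rabs_triang | rewrite Rabs_Ropp; lra]. }
  assert (c * Rabs y <= Rabs t + Rabs (t - c * y)).
  { eapply Rle_trans with (Rabs (c * y)).
    - rewrite Rabs_mult. apply Rmult_le_compat_r; [apply Rabs_pos | apply Rle_abs].
    - replace (c * y) with (t + - (t - c * y)) at 1 by ring.
      eapply Rle_trans; [apply Rabs_triang | rewrite Rabs_Ropp; lra]. }
  lra.
Qed.

Lemma geometric_steps_converge (x : nat -> R) (C : R) :
  (forall n, Rabs (x (S n) - x n) <= C * (1 / 2) ^ n) -> ex_finite_lim_seq x.
Proof.
  intros H.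
  assert (S : ex_series (fun n => x (S n) - x n)).
  { apply (@ex_series_le R_AbsRing R_CompleteNormedModule _ (fun n => C * (1 / 2) ^ n)); [exact H |].
    apply (ex_series_scal_l C (fun n => (1 / 2) ^ n)).
    apply ex_series_geom. rewrite Rabs_pos_eq; lra. }
  destruct S as [l Hl]. exists (l + x O).
  (* The increments up to index [n] telescope to [x (S n) - x 0], hence the shifted sequence. *)
  apply is_lim_seq_incr_1.
  apply is_lim_seq_ext with (fun n => sum_n (fun k => x (S k) - x k) n + x O).
  - intros n. induction n.
    + rewrite sum_O. ring.
    + rewrite sum_Sn. unfold plus; simpl. lra.
  - apply (is_lim_seq_plus' _ _ l (x O)); [exact Hl | apply is_lim_seq_const].
Qed.

(** A preimage of [w] is a fixed point of [T z = z - ((a + i b) z - w) / c]. This map halves l1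
    distances on [V] and moves [q] by at most [r / 2], so the orbit of [q] never leaves the closed
    l1 ball of radius [r], where it converges. *)
Lemma near_scaling_open (V : R * R -> Prop) (a b : R * R -> R) (c : R) (q : R * R) :
  open V -> 0 < c -> near_scaling V a b c -> V q ->
  exists r, 0 < r /\ forall w, dist1 (a q, b q) w < r -> exists z, V z /\ (a z, b z) = w.
Proof.
  intros HV Hc H Hq. destruct (HV q Hq) as [e He].
  (* Half of [e] puts the closed l1 ball of radius [r] inside the open square of radius [e]. *)
  set (r := e / 2). assert (Hr : 0 < r) by (unfold r; destruct e; simpl; lra).
  assert (Hin : forall z, dist1 q z <= r -> V z).
  { intros z Hz. apply He. apply (proj2 (ball_box _ _ _)). unfold dist1 in Hz.
    assert (K1 := Rabs_pos (fst z - fst q)). assert (K2 := Rabs_pos (snd z - snd q)).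
    unfold r in *; split; simpl; lra. }
  (* The displacement of [q] under [T] is the distance from [(a q, b q)] to [w] divided by [c]; this
     radius bounds it by [r / 2]. *)
  exists (c * r / 2). split; [apply Rdiv_lt_0_compat; nra |].
  intros [s t] Hw. unfold dist1 in Hw; simpl in Hw.
  set (T := fun z : R * R => (fst z - (a z - s) / c, snd z - (b z - t) / c)).
  assert (HT : forall z w, V z -> V w -> dist1 (T z) (T w) <= dist1 z w / 2).
  { intros z w Hz Hw'. specialize (H z w Hz Hw'). unfold dist1 in *; simpl.
    replace (fst w - (a w - s) / c - (fst z - (a z - s) / c))
      with (- / c * (a w - a z - c * (fst w - fst z))) by (field; lra).
    replace (snd w - (b w - t) / c - (snd z - (b z - t) / c))
      with (- / c * (b w - b z - c * (snd w - snd z))) by (field; lra).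
    rewrite !Rabs_mult, Rabs_Ropp, (Rabs_pos_eq (/ c)) by (left; now apply Rinv_0_lt_compat).
    rewrite <- Rmult_plus_distr_l. apply Rmult_le_reg_l with c; trivial.
    rewrite <- Rmult_assoc, Rinv_r, Rmult_1_l by lra. lra. }
  assert (Tq : dist1 q (T q) <= r / 2).
  { unfold dist1; simpl.
    replace (fst q - (a q - s) / c - fst q) with (/ c * (s - a q)) by (field; lra).
    replace (snd q - (b q - t) / c - snd q) with (/ c * (t - b q)) by (field; lra).
    rewrite !Rabs_mult, (Rabs_pos_eq (/ c)) by (left; now apply Rinv_0_lt_compat).
    rewrite <- Rmult_plus_distr_l. apply Rmult_le_reg_l with c; trivial.
    rewrite <- Rmult_assoc, Rinv_r, Rmult_1_l by lra. lra. }
  assert (Htri : forall x y z, dist1 x z <= dist1 x y + dist1 y z).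
  { intros x y z. unfold dist1.
    assert (K1 := Rabs_triang (fst z - fst y) (fst y - fst x)).
    assert (K2 := Rabs_triang (snd z - snd y) (snd y - snd x)).
    replace (fst z - fst y + (fst y - fst x)) with (fst z - fst x) in K1 by ring.
    replace (snd z - snd y + (snd y - snd x)) with (snd z - snd x) in K2 by ring. lra. }
  set (Z := fun n => Nat.iter n T q).
  assert (HZ : forall n, dist1 q (Z n) <= r).
  { induction n.
    - unfold Z, dist1; simpl. rewrite !Rminus_diag, Rabs_R0. lra.
    - change (Z (S n)) with (T (Z n)). specialize (HT q (Z n) Hq (Hin _ IHn)).
      specialize (Htri q (T q) (T (Z n))). lra. }
  assert (HS : forall n, dist1 (Z n) (Z (S n)) <= r / 2 * (1 / 2) ^ n).
  { induction n.
    - simpl. rewrite Rmult_1_r. exact Tq.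
    - change (Z (S (S n))) with (T (Z (S n))). change (Z (S n)) with (T (Z n)) at 1.
      specialize (HT (Z n) (Z (S n)) (Hin _ (HZ n)) (Hin _ (HZ (S n)))). simpl pow. lra. }
  assert (LX : ex_finite_lim_seq (fun n => fst (Z n))).
  { apply geometric_steps_converge with (r / 2). intros n. specialize (HS n). unfold dist1 in HS.
    assert (K := Rabs_pos (snd (Z (S n)) - snd (Z n))). lra. }
  assert (LY : ex_finite_lim_seq (fun n => snd (Z n))).
  { apply geometric_steps_converge with (r / 2). intros n. specialize (HS n). unfold dist1 in HS.
    assert (K := Rabs_pos (fst (Z (S n)) - fst (Z n))). lra. }
  destruct LX as [x LX], LY as [y LY].
  assert (LD : forall u : R * R, is_lim_seq (fun n => dist1 u (Z n)) (dist1 u (x, y))).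
  { intros u. unfold dist1; simpl.
    apply (is_lim_seq_plus' _ _ (Rabs (x - fst u)) (Rabs (y - snd u))).
    - apply (is_lim_seq_abs _ (x - fst u)). apply is_lim_seq_minus'; trivial. apply is_lim_seq_const.
    - apply (is_lim_seq_abs _ (y - snd u)). apply is_lim_seq_minus'; trivial. apply is_lim_seq_const. }
  assert (Hxy : V (x, y)).
  { apply Hin.
    assert (L := is_lim_seq_le _ _ _ _ HZ (LD q) (is_lim_seq_const r)). exact L. }
  (* The limit is fixed: [Z (S n) = T (Z n)] approaches [T (x, y)] by contraction, while it also
     converges to [(x, y)]. *)
  assert (LT : is_lim_seq (fun n => dist1 (T (x, y)) (Z (S n))) 0).
  { apply is_lim_seq_le_le with (fun _ => 0) (fun n => dist1 (x, y) (Z n) / 2).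
    - intros n. split.
      + unfold dist1. apply Rplus_le_le_0_compat; apply Rabs_pos.
      + apply (HT (x, y) (Z n) Hxy (Hin _ (HZ n))).
    - apply is_lim_seq_const.
    - evar_last.
      + apply (is_lim_seq_div' _ _ (dist1 (x, y) (x, y)) 2); [apply LD | apply is_lim_seq_const | lra].
      + unfold dist1; simpl. rewrite !Rminus_diag, Rabs_R0. f_equal; field. }
  assert (E : dist1 (T (x, y)) (x, y) = 0).
  { assert (L := LD (T (x, y))). apply is_lim_seq_incr_1 in L.
    assert (U := is_lim_seq_unique _ _ L). rewrite (is_lim_seq_unique _ _ LT) in U.
    injection U; auto. }
  exists (x, y); split; trivial.
  unfold dist1, T in E; simpl in E.
  assert (K1 := Rabs_pos (x - (x - (a (x, y) - s) / c))).
  assert (K2 := Rabs_pos (y - (y - (b (x, y) - t) / c))).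
  assert (E1 : Rabs (x - (x - (a (x, y) - s) / c)) = 0) by lra.
  assert (E2 : Rabs (y - (y - (b (x, y) - t) / c)) = 0) by lra.
  apply Rabs_eq_0 in E1, E2.
  f_equal.
  - apply Rminus_diag_uniq. replace (a (x, y) - s) with (c * ((a (x, y) - s) / c)) by (field; lra).
    replace ((a (x, y) - s) / c) with 0 by lra. ring.
  - apply Rminus_diag_uniq. replace (b (x, y) - t) with (c * ((b (x, y) - t) / c)) by (field; lra).
    replace ((b (x, y) - t) / c) with 0 by lra. ring.
Qed.

Lemma differentiable_is_derive (f : R * R -> R) (q : R * R) (lx ly : R) :
  differentiable_pt_lim (fun x y => f (x, y)) (fst q) (snd q) lx ly ->
  is_derive (fun t => f (t, snd q)) (fst q) lx /\ is_derive (fun t => f (fst q, t)) (snd q) ly.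
Proof.
  intros D. split.
  - evar_last.
    + apply (is_derive_comp_2d f (fun t => t) (fun _ => snd q) (fst q) lx ly 1 0 D);
       [apply @is_derive_id | apply @is_derive_const].
    + ring.
  - evar_last.
    + apply (is_derive_comp_2d f (fun _ => fst q) (fun t => t) (snd q) lx ly 0 1 D);
       [apply @is_derive_const | apply @is_derive_id].
    + ring.
Qed.

(** * Regularity of the inverse of a holomorphic map *)

Section Inverse.

Variables (V U : R * R -> Prop) (a b u v h1 h2 : R * R -> R) (L : R).
Hypothesis (HV : open V) (HU : open U).
Hypothesis (Ha : has_partials V a u (fun z => - v z)) (Hb : has_partials V b v u).
Hypothesis (Cu : forall z, V z -> continuous u z) (Cv : forall z, V z -> continuous v z).
Hypothesis (Huv : forall z, V z -> u z * u z + v z * v z <> 0).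
Hypothesis (HUV : forall q, U q -> V (h1 q, h2 q)).
Hypothesis (Hinv : forall q, U q -> (a (h1 q, h2 q), b (h1 q, h2 q)) = q).
Hypothesis (HL : 0 < L).
Hypothesis (Hlip : forall q w, U q -> U w ->
  Rabs (h1 w - h1 q) <= L * Rmax (Rabs (fst w - fst q)) (Rabs (snd w - snd q)) /\
  Rabs (h2 w - h2 q) <= L * Rmax (Rabs (fst w - fst q)) (Rabs (snd w - snd q))).

(** Expand [a + i b] to first order at [z] and solve the linear system by multiplying with
    [(u - i v) / m], the reciprocal of the derivative. The remainder is small relative to the
    displacement of [(h1, h2)], and the Lipschitz bound makes it small relative to the displacement
    of [q]. *)
Lemma conformal_inverse_differentiable (q : R * R) : U q ->
  let z := (h1 q, h2 q) in let m := u z * u z + v z * v z in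
  differentiable_pt_lim (fun x y => h1 (x, y)) (fst q) (snd q) (u z / m) (v z / m) /\
  differentiable_pt_lim (fun x y => h2 (x, y)) (fst q) (snd q) (- v z / m) (u z / m).
Proof.
  intros Hq z m. specialize (HUV q Hq). fold z in HUV. specialize (Huv z HUV).
  fold m in Huv.
  assert (Da := has_partials_differentiable V a _ _ z HV Ha HUV (Cu z HUV)).
  assert (Db := has_partials_differentiable V b _ _ z HV Hb HUV (Cv z HUV)).
  assert (Hm : 0 < m).
  { assert (0 <= m) by (unfold m; nra). lra. }
  set (k := Rabs (u z) + Rabs (v z)).
  assert (Hk : 0 < k).
  { unfold k. assert (K1 := Rabs_pos (u z)). assert (K2 := Rabs_pos (v z)).
    destruct (Req_dec (u z) 0) as [E|E]; [|apply Rabs_pos_lt in E; lra].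
    destruct (Req_dec (v z) 0) as [E'|E']; [|apply Rabs_pos_lt in E'; lra].
    exfalso. unfold m in Hm; rewrite E, E' in Hm. lra. }
  assert (Key : forall eps : posreal, exists delta : posreal, forall x y,
     Rabs (x - fst q) < delta -> Rabs (y - snd q) < delta ->
     Rabs (h1 (x, y) - h1 q - (u z / m * (x - fst q) + v z / m * (y - snd q)))
       <= eps * Rmax (Rabs (x - fst q)) (Rabs (y - snd q)) /\
     Rabs (h2 (x, y) - h2 q - (- v z / m * (x - fst q) + u z / m * (y - snd q)))
       <= eps * Rmax (Rabs (x - fst q)) (Rabs (y - snd q))).
  { intros eps.
    (* The factor [L] pays for passing from displacements in [V] to those in [U]; [k / m] bounds the
       effect of the inverse matrix on the remainders. *)
    assert (He : 0 < eps * m / (k * L)).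
    { apply Rdiv_lt_0_compat; apply Rmult_lt_0_compat; trivial. apply cond_pos. }
    destruct (Da (mkposreal _ He)) as [d1 D1], (Db (mkposreal _ He)) as [d2 D2].
    assert (Loc := HU q Hq). destruct Loc as [d3 D3].
    (* The bound [d3] keeps the point in [U]; the division by [L] keeps its image under [(h1, h2)]
       where both expansions are valid. *)
    assert (Hd : 0 < Rmin d3 (Rmin d1 d2 / L)).
    { apply Rmin_pos; [apply cond_pos |]. apply Rdiv_lt_0_compat; trivial.
      apply Rmin_pos; apply cond_pos. }
    exists (mkposreal _ Hd). simpl. intros x y Hx Hy.
    assert (Hw : U (x, y)).
    { apply D3. apply (proj2 (ball_box _ _ _)). simpl.
      assert (K := Rmin_l d3 (Rmin d1 d2 / L)). split; lra. }
    set (M := Rmax (Rabs (x - fst q)) (Rabs (y - snd q))).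
    assert (HM : 0 <= M).
    { unfold M. eapply Rle_trans; [| apply Rmax_l]. apply Rabs_pos. }
    assert (HLM : L * M < Rmin d1 d2).
    { apply Rmult_lt_reg_l with (/ L); [now apply Rinv_0_lt_compat |].
      rewrite <- Rmult_assoc, Rinv_l, Rmult_1_l by lra.
      rewrite Rmult_comm. change (M < Rmin d1 d2 / L).
      eapply Rlt_le_trans; [| apply (Rmin_r d3)]. now apply Rmax_lub_lt. }
    assert (K1 := Rmin_l d1 d2). assert (K2 := Rmin_r d1 d2).
    destruct (Hlip q (x, y) Hq Hw) as [L1 L2]; simpl in L1, L2. fold M in L1, L2.
    change (h1 q) with (fst z) in L1 |- *. change (h2 q) with (snd z) in L2 |- *.
    specialize (D1 (h1 (x, y)) (h2 (x, y)) ltac:(lra) ltac:(lra)).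
    specialize (D2 (h1 (x, y)) (h2 (x, y)) ltac:(lra) ltac:(lra)).
    simpl pos in D1, D2. rewrite <- surjective_pairing in D1, D2.
    assert (I1 := Hinv (x, y) Hw). injection I1 as Ia Ib.
    assert (I2 := Hinv q Hq). fold z in I2. rewrite (surjective_pairing q) in I2.
    injection I2 as Ja Jb.
    rewrite Ia, Ja in D1. rewrite Ib, Jb in D2.
    set (p1 := h1 (x, y) - fst z) in *. set (p2 := h2 (x, y) - snd z) in *.
    set (o1 := x - fst q - _) in D1. set (o2 := y - snd q - _) in D2.
    assert (B : forall o, Rabs o <= eps * m / (k * L) * Rmax (Rabs p1) (Rabs p2) ->
                 Rabs o <= eps * m / k * M).
    { intros o Ho. eapply Rle_trans; [exact Ho |].
      apply Rle_trans with (eps * m / (k * L) * (L * M)).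
      - apply Rmult_le_compat_l; [lra |]. now apply Rmax_lub.
      - right. field. lra. }
    apply B in D1, D2.
    assert (F : forall s t, Rabs s + Rabs t = k -> Rabs (- (s * o1 + t * o2) / m) <= eps * M).
    { intros s t Hst. unfold Rdiv. rewrite Rabs_mult, Rabs_Ropp, (Rabs_pos_eq (/ m))
        by (left; now apply Rinv_0_lt_compat).
      apply Rmult_le_reg_r with m; trivial. rewrite Rmult_assoc, Rinv_l, Rmult_1_r by lra.
      eapply Rle_trans; [apply Rabs_triang |]. rewrite !Rabs_mult.
      apply Rle_trans with (Rabs s * (eps * m / k * M) + Rabs t * (eps * m / k * M)).
      - apply Rplus_le_compat; apply Rmult_le_compat_l; trivial; apply Rabs_pos.
      - rewrite <- Rmult_plus_distr_r, Hst. right. field. lra. }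
    split.
    (* With [o1], [o2] the remainders, [x - fst q = u p1 - v p2 + o1] and
       [y - snd q = v p1 + u p2 + o2], coefficients taken at [z]; eliminating [p2] leaves this error
       term. *)
    - replace (p1 - _) with (- (u z * o1 + v z * o2) / m).
      + now apply F.
      + unfold o1, o2, m. field. exact Huv.
    - replace (p2 - _) with (- (- v z * o1 + u z * o2) / m).
      + apply F. rewrite Rabs_Ropp. unfold k; ring.
      + unfold o1, o2, m. field. exact Huv. }
  split; intros eps; destruct (Key eps) as [d Hd]; exists d; intros x y Hx Hy;
    rewrite <- surjective_pairing; now apply Hd.
Qed.

(** Bootstrap: the partials of [h1] and [h2] are C^n functions composed with [(h1, h2)], so class
    C^n of the pair gives class C^n of its partials, hence C^(n+1). *)
Lemma conformal_inverse_Ck : (forall n, Ck V n u) -> (forall n, Ck V n v) ->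
  forall n, Ck U n h1 /\ Ck U n h2.
Proof.
  intros Ru Rv.
  set (m := fun z => u z * u z + v z * v z).
  assert (Rm : forall n, Ck V n (fun z => / m z)).
  { intros n. apply Ck_inv; trivial. apply Ck_plus; trivial; now apply Ck_mult. }
  induction n.
  - split; apply Ck_0; intros q Hq; apply continuous_continuity_2d, differentiable_continuity_pt;
      do 2 eexists; apply (conformal_inverse_differentiable q Hq).
  - assert (P1 : has_partials U h1 (fun q => u (h1 q, h2 q) * / m (h1 q, h2 q))
                   (fun q => v (h1 q, h2 q) * / m (h1 q, h2 q))).
    { intros q Hq. apply differentiable_is_derive. apply (conformal_inverse_differentiable q Hq). }
    assert (P2 : has_partials U h2 (fun q => - v (h1 q, h2 q) * / m (h1 q, h2 q))
                   (fun q => u (h1 q, h2 q) * / m (h1 q, h2 q))).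
    { intros q Hq. apply differentiable_is_derive. apply (conformal_inverse_differentiable q Hq). }
    destruct IHn as [R1 R2].
    assert (Cm : Ck U n (fun q => / m (h1 q, h2 q)))
      by now apply (Ck_comp_2d V U n (fun z => / m z) h1 h2).
    assert (Cu' : Ck U n (fun q => u (h1 q, h2 q)))
      by now apply (Ck_comp_2d V U n u h1 h2).
    assert (Cv' : Ck U n (fun q => v (h1 q, h2 q)))
      by now apply (Ck_comp_2d V U n v h1 h2).
    split.
    + eapply Ck_S; [trivial | exact P1 | |]; now apply Ck_mult.
    + eapply Ck_S; [trivial | exact P2 | |]; apply Ck_mult; trivial. now apply Ck_opp.
Qed.

End Inverse.

(** * Simply connected boxes *)

Definition affine_path (p q : R * R) (t : R) : R * R :=
  ((1 - t) * fst p + t * fst q, (1 - t) * snd p + t * snd q).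

Lemma affine_path_0 (p q : R * R) : affine_path p q 0 = p.
Proof. destruct p; unfold affine_path; simpl; f_equal; ring. Qed.

Lemma affine_path_1 (p q : R * R) : affine_path p q 1 = q.
Proof. destruct q; unfold affine_path; simpl; f_equal; ring. Qed.

Lemma affine_path_diag (p : R * R) (t : R) : affine_path p p t = p.
Proof. destruct p; unfold affine_path; simpl; f_equal; ring. Qed.

Lemma filterlim_affine_path {T : Type} (F : (T -> Prop) -> Prop) {FF : Filter F}
    (f : T -> R * R) (h : T -> R) (l q : R * R) (t : R) :
  filterlim f F (locally l) -> filterlim h F (locally t) ->
  filterlim (fun z => affine_path (f z) q (h z)) F (locally (affine_path l q t)).
Proof.
  intros Hf Hh.
  assert (H1 : filterlim (fun z => 1 - h z) F (locally (1 - t))).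
  { apply (filterlim_comp_2 (fun _ => 1) (fun z => - h z) Rplus (filterlim_const 1)
      (filterlim_comp _ _ _ h Ropp _ _ _ Hh (filterlim_opp t)) (filterlim_plus 1 (- t))). }
  assert (K : forall (g : R * R -> R), continuous g l ->
     filterlim (fun z => (1 - h z) * g (f z) + h z * g q) F (locally ((1 - t) * g l + t * g q))).
  { intros g Cg.
    assert (Hg : filterlim (fun z => g (f z)) F (locally (g l)))
      by (apply (filterlim_comp _ _ _ f g _ _ _ Hf Cg)).
    apply (filterlim_comp_2 (fun z => (1 - h z) * g (f z)) (fun z => h z * g q) Rplus
       (filterlim_comp_2 _ _ Rmult H1 Hg (filterlim_mult (1 - t) (g l)))
       (filterlim_comp_2 _ _ Rmult Hh (filterlim_const (g q)) (filterlim_mult t (g q)))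
       (filterlim_plus ((1 - t) * g l) (t * g q))). }
  apply (filterlim_locally_pair F); [apply (K fst) | apply (K snd)]; destruct l;
    [apply continuous_fst | apply continuous_snd].
Qed.

(** Segments give the paths, and each loop is contracted along the segments from its points to its
    base point. *)
Lemma convex_simply_connected (V : R * R -> Prop) :
  (forall p q t, V p -> V q -> unit_interval t -> V (affine_path p q t)) ->
  simply_connected V.
Proof.
  intros HV. split.
  - intros p q Hp Hq. exists (affine_path p q). split; [split |].
    + apply continuous_on_forall. intros t _.
      apply (filterlim_affine_path (locally t) (fun _ => p) (fun s => s));
        [apply filterlim_const | apply filterlim_id].
    + auto.
    + now rewrite affine_path_0, affine_path_1.
  - intros gamma [Cg Hg] E.
    exists (fun z => affine_path (gamma (snd z)) (gamma 0) (fst z)).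
    split; [| split; [| split]].
    + intros [s t] [Hs Ht]; simpl in *.
      apply (filterlim_affine_path (within unit_square (locally (s, t)))
        (fun z => gamma (snd z)) fst).
      (* The loop is continuous only relative to the unit interval, so the filter restricted to the
         square is pushed along [snd] to the one restricted to the interval. *)
      * apply (filterlim_comp _ _ _ snd gamma _ (within unit_interval (locally t))).
        -- intros P HP. unfold filtermap, within in *.
           assert (HQ : locally (s, t) (fun z => unit_interval (snd z) -> P (snd z)))
             by exact (continuous_snd s t _ HP).
           revert HQ. apply filter_imp.
           intros z Hz [_ Hz2]. now apply Hz.
        -- now apply Cg.
      * eapply filterlim_filter_le_1; [apply filter_le_within | apply continuous_fst].
    + intros [s t] [Hs Ht]; simpl in *. apply HV; trivial; apply Hg; trivial.
      split; lra.
    + intros t Ht; simpl. now rewrite affine_path_0, affine_path_1.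
    + intros s Hs; simpl. rewrite <- E. now rewrite affine_path_diag.
Qed.

Lemma ball_simply_connected (p : R * R) (d : R) : simply_connected (ball p d).
Proof.
  apply convex_simply_connected. intros z w t Hz Hw Ht.
  apply (proj1 (ball_box _ _ _)) in Hz. apply (proj1 (ball_box _ _ _)) in Hw.
  apply (proj2 (ball_box _ _ _)). unfold affine_path; simpl.
  assert (K : forall x y c, Rabs (x - c) < d -> Rabs (y - c) < d ->
    Rabs ((1 - t) * x + t * y - c) < d).
  { intros x y c Hx Hy. apply Rabs_lt_between' in Hx. apply Rabs_lt_between' in Hy.
    apply Rabs_lt_between'. destruct Ht as [Ht0 Ht1].
    assert (P : forall r r', 0 < r -> 0 < r' -> 0 < (1 - t) * r + t * r').
    { intros r r' Hr Hr'. destruct (Req_dec t 0) as [-> | Ht]; [lra |].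
      apply Rplus_le_lt_0_compat; [apply Rmult_le_pos | apply Rmult_lt_0_compat]; lra. }
    assert (P1 := P (x - (c - d)) (y - (c - d)) ltac:(lra) ltac:(lra)).
    assert (P2 := P (c + d - x) (c + d - y) ltac:(lra) ltac:(lra)).
    split; lra. }
  split; now apply K.
Qed.

(** * The logarithm of the modulus of a holomorphic function *)

(* [(a + i b)' = u + i v] and [(u + i v)' = A - i B]. *)
Lemma harmonic_primitive (phi : R * R -> R) (p : R * R) :
  harmonic_on (fun _ => True) phi ->
  exists u v A B a b : R * R -> R,
    has_partials (fun _ => True) u A B /\
    has_partials (fun _ => True) v (fun q => - B q) A /\
    has_partials (fun _ => True) a u (fun q => - v q) /\
    has_partials (fun _ => True) b v u /\
    (forall n, Ck (fun _ => True) n u) /\ (forall n, Ck (fun _ => True) n v) /\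
    (forall q, u q * u q + v q * v q = exp (2 * phi q)) /\
    a p = 1 /\ b p = 0 /\ 0 < u p /\ v p = 0.
Proof.
  intros [Sm Hl].
  assert (HT : open (fun _ : R * R => True)) by apply open_true.
  assert (R0 : forall n, Ck (fun _ => True) n phi) by (intros n q Hq; now apply Sm).
  assert (Hphi := proj1 (Ck_S_inv _ _ _ (R0 1%nat))).
  assert (Rx : forall n, Ck (fun _ => True) n (dx phi)) by (intros n; exact (proj1 (proj2 (Ck_S_inv _ _ _ (R0 (S n)))))).
  assert (Ry : forall n, Ck (fun _ => True) n (dy phi)) by (intros n; exact (proj2 (proj2 (Ck_S_inv _ _ _ (R0 (S n)))))).
  assert (Ny : forall n, Ck (fun _ => True) n (fun q => - dy phi q)) by (intros n; now apply Ck_opp).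
  assert (Hx := proj1 (Ck_S_inv _ _ _ (Rx 1%nat))).
  assert (Hy := has_partials_opp _ _ _ _ (proj1 (Ck_S_inv _ _ _ (Ry 1%nat)))).
  (* The form [- phi_y dx + phi_x dy] is closed exactly because the Laplacian of [phi] vanishes. The
     value 0 at [p] later gives [v p = 0] and [u p > 0]. *)
  destruct (closed_form_exact _ _ _ _ _ _ p 0 Hy Hx) as (psi & psi0 & Hpsi).
  { intros q. assert (L := Hl q I). unfold laplacian in L. lra. }
  { intros q. now apply (Ck_continuous (fun _ => True) 0). }
  { intros q. now apply (Ck_continuous (fun _ => True) 0). }
  { intros q. apply (Ck_continuous (fun _ => True) 0); trivial. exact (proj1 (proj2 (Ck_S_inv _ _ _ (Rx 1%nat)))). }
  destruct (has_partials_polar _ _ _ _ _ Hphi Hpsi) as [Hu Hv].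
  set (u := fun q => exp (phi q) * cos (psi q)) in *.
  set (v := fun q => exp (phi q) * sin (psi q)) in *.
  set (A := fun q => u q * dx phi q + v q * dy phi q).
  set (B := fun q => u q * dy phi q - v q * dx phi q).
  assert (Ru : forall n, Ck (fun _ => True) n u)
    by (intros n; now apply (Ck_polar (fun _ => True) n phi psi (dx phi) (dy phi))).
  assert (Rv : forall n, Ck (fun _ => True) n v)
    by (intros n; now apply (Ck_polar (fun _ => True) n phi psi (dx phi) (dy phi))).
  assert (HuAB : has_partials (fun _ => True) u A B) by exact Hu.
  assert (HvAB : has_partials (fun _ => True) v (fun q => - B q) A).
  { revert Hv. apply has_partials_ext; trivial; intros q _; unfold A, B, u, v; ring. }
  assert (HnvAB : has_partials (fun _ => True) (fun q => - v q) B (fun q => - A q)).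
  { generalize (has_partials_opp _ _ _ _ HvAB). apply has_partials_ext; trivial.
    intros q _. apply Ropp_involutive. }
  assert (RA : Ck (fun _ => True) 0 A) by (apply Ck_plus; trivial; now apply Ck_mult).
  assert (RB : Ck (fun _ => True) 0 B) by (apply Ck_minus; trivial; now apply Ck_mult).
  assert (C0 : forall f, Ck (fun _ => True) 0 f -> forall q, continuous f q)
    by (intros f Hf q; now apply (Ck_continuous (fun _ => True) 0)).
  (* Real and imaginary parts of [(u + i v) (dx + i dy)]: the forms [u dx - v dy] and [v dx + u dy]
     are closed by the Cauchy-Riemann equations for [u + i v]. *)
  destruct (closed_form_exact u A B (fun q => - v q) B (fun q => - A q) p 1) as (a & a1 & Ha); auto.
  { apply C0. now apply Ck_opp. }
  destruct (closed_form_exact v (fun q => - B q) A u A B p 0) as (b & b0 & Hb); auto.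
  exists u, v, A, B, a, b. repeat (split; [assumption |]).
  split; [| split; [| split; [| split]]]; trivial.
  - intros q. unfold u, v. replace (2 * phi q) with (phi q + phi q) by ring. rewrite exp_plus.
    assert (T := sin2_cos2 (psi q)). unfold Rsqr in T.
    replace (_ + _) with (exp (phi q) * exp (phi q) *
       (sin (psi q) * sin (psi q) + cos (psi q) * cos (psi q))) by ring.
    rewrite T; ring.
  - unfold u. rewrite psi0, cos_0, Rmult_1_r. apply exp_pos.
  - unfold v. rewrite psi0, sin_0. ring.
Qed.

(** The mean value bound is applied to [a - c x] and [b - c y], whose partials are [u - c] and [v]
    up to order and sign; each coordinate contributes [c / 4], together the [c / 2] of
    [near_scaling]. *)
Lemma box_near_scaling (p : R * R) (d c : R) (a b u v : R * R -> R) :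
  has_partials (ball p d) a u (fun q => - v q) -> has_partials (ball p d) b v u ->
  (forall q, ball p d q -> Rabs (u q - c) <= c / 4 /\ Rabs (v q) <= c / 4) ->
  near_scaling (ball p d) a b c.
Proof.
  intros Ha Hb Hc z w Hz Hw.
  assert (D : forall t, is_derive (fun s : R => - c * s) t (- c))
    by (intros t; auto_derive; trivial; ring).
  assert (Ma : Rabs ((a w + - c * fst w) - (a z + - c * fst z)) <= c / 4 * dist1 z w).
  { apply (box_mean_value p d (c / 4) (fun q => a q + - c * fst q) (fun q => u q + - c) (fun q => - v q + 0)); trivial.
    - intros q Hq. destruct (Ha q Hq) as [D1 D2]. split.
      + exact (is_derive_plus (fun t => a (t, snd q)) (fun t => - c * t) _ _ _ D1 (D _)).
      + exact (is_derive_plus (fun t => a (fst q, t)) _ _ _ _ D2 (is_derive_const (- c * fst q) _)).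
    - intros q Hq. rewrite Rplus_0_r, Rabs_Ropp. now apply Hc. }
  assert (Mb : Rabs ((b w + - c * snd w) - (b z + - c * snd z)) <= c / 4 * dist1 z w).
  { apply (box_mean_value p d (c / 4) (fun q => b q + - c * snd q) (fun q => v q + 0) (fun q => u q + - c)); trivial.
    - intros q Hq. destruct (Hb q Hq) as [D1 D2]. split.
      + exact (is_derive_plus (fun t => b (t, snd q)) _ _ _ _ D1 (is_derive_const (- c * snd q) _)).
      + exact (is_derive_plus (fun t => b (fst q, t)) (fun t => - c * t) _ _ _ D2 (D _)).
    - intros q Hq. rewrite Rplus_0_r. destruct (Hc q Hq); now split. }
  replace (a w - a z - _) with ((a w + - c * fst w) - (a z + - c * fst z)) by ring.
  replace (b w - b z - _) with ((b w + - c * snd w) - (b z + - c * snd z)) by ring.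
  lra.
Qed.

Section LogModulus.

Variables (V : R * R -> Prop) (a b u v A B : R * R -> R).
Hypothesis (HV : open V).
Hypothesis (Hu : has_partials V u A B) (Hv : has_partials V v (fun q => - B q) A).
Hypothesis (Ha : has_partials V a u (fun q => - v q)) (Hb : has_partials V b v u).
Hypothesis (Ru : forall n, Ck V n u) (Rv : forall n, Ck V n v).
Hypothesis (Hm : forall q, V q -> 0 < a q * a q + b q * b q).

Definition log_modulus (q : R * R) : R := / 2 * ln (a q * a q + b q * b q).

(** Together with [log_modulus_y] this encodes the logarithmic derivative: [(u + i v) / (a + i b) =
    log_modulus_x - i log_modulus_y]. *)
Definition log_modulus_x (q : R * R) : R := (a q * u q + b q * v q) * / (a q * a q + b q * b q).

Definition log_modulus_y (q : R * R) : R := (b q * u q - a q * v q) * / (a q * a q + b q * b q).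

Lemma has_partials_norm2 : has_partials V (fun q => a q * a q + b q * b q)
  (fun q => u q * a q + a q * u q + (v q * b q + b q * v q))
  (fun q => - v q * a q + a q * - v q + (u q * b q + b q * u q)).
Proof.
  apply has_partials_plus.
  - apply (has_partials_mult V a u (fun q => - v q) a u (fun q => - v q)); trivial.
  - apply has_partials_mult; trivial.
Qed.

Lemma has_partials_log_modulus : has_partials V log_modulus log_modulus_x log_modulus_y.
Proof.
  assert (L := has_partials_comp V ln Rinv _ _ _ (fun q Hq => is_derive_ln _ (Hm q Hq)) has_partials_norm2).
  assert (L2 := has_partials_mult V _ _ _ _ _ _ (has_partials_const V (/ 2)) L).
  revert L2. apply has_partials_ext; trivial; intros q Hq; specialize (Hm q Hq); simpl;
    unfold log_modulus_x, log_modulus_y; field; lra.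
Qed.

Lemma Ck_log_modulus_partials (n : nat) : Ck V n log_modulus_x /\ Ck V n log_modulus_y.
Proof.
  assert (Ra : Ck V n a).
  { apply (Ck_partials V n a u (fun q => - v q)); trivial. now apply Ck_opp. }
  assert (Rb : Ck V n b) by now apply (Ck_partials V n b v u).
  assert (Rm : Ck V n (fun q => / (a q * a q + b q * b q))).
  { apply Ck_inv; trivial.
    - intros q Hq; specialize (Hm q Hq); lra.
    - apply Ck_plus; trivial; now apply Ck_mult. }
  split; apply Ck_mult; trivial; [apply Ck_plus | apply Ck_minus]; trivial; now apply Ck_mult.
Qed.

(** The second partials are computed by the product and quotient rules; their sum vanishes as a
    rational identity in [a], [b], [u], [v], [A], [B]. *)
Lemma harmonic_log_modulus : harmonic_on V log_modulus.
Proof.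
  assert (H := has_partials_log_modulus).
  split.
  - intros q Hq n. apply (Ck_partials V n log_modulus log_modulus_x log_modulus_y); trivial;
      apply Ck_log_modulus_partials.
  - intros q Hq.
    assert (I := has_partials_inv V _ _ _ (fun q Hq => Rgt_not_eq _ _ (Hm q Hq)) has_partials_norm2).
    assert (X1 := has_partials_mult _ _ _ _ _ _ _ (has_partials_plus _ _ _ _ _ _ _
       (has_partials_mult _ _ _ _ _ _ _ Ha Hu) (has_partials_mult _ _ _ _ _ _ _ Hb Hv)) I).
    assert (Y1 := has_partials_mult _ _ _ _ _ _ _ (has_partials_plus _ _ _ _ _ _ _
       (has_partials_mult _ _ _ _ _ _ _ Hb Hu)
       (has_partials_opp _ _ _ _ (has_partials_mult _ _ _ _ _ _ _ Ha Hv))) I).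
    (* The Laplacian differentiates [dx log_modulus], which agrees with the explicit formula only on
       [V]; openness of [V] allows the transfer. *)
    assert (Ex : forall z, V z -> log_modulus_x z = dx log_modulus z).
    { intros z Hz. symmetry. exact (proj1 (has_partials_unique V _ _ _ H z Hz)). }
    assert (Ey : forall z, V z -> log_modulus_y z = dy log_modulus z).
    { intros z Hz. symmetry. exact (proj2 (has_partials_unique V _ _ _ H z Hz)). }
    assert (X2 := has_partials_ext V _ _ _ _ _ _ HV Ex (fun _ _ => eq_refl) (fun _ _ => eq_refl) X1).
    assert (Y2 := has_partials_ext V _ _ _ _ _ _ HV Ey (fun _ _ => eq_refl) (fun _ _ => eq_refl) Y1).
    unfold laplacian.
    rewrite (proj1 (has_partials_unique V _ _ _ X2 q Hq)),
      (proj2 (has_partials_unique V _ _ _ Y2 q Hq)); simpl.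
    specialize (Hm q Hq). field. lra.
Qed.

End LogModulus.

Lemma exp_log_modulus (a b : R * R -> R) (q : R * R) : 0 < a q * a q + b q * b q ->
  exp (log_modulus a b q) * exp (log_modulus a b q) = a q * a q + b q * b q.
Proof.
  intros H. rewrite <- exp_plus. unfold log_modulus.
  replace (_ + _) with (ln (a q * a q + b q * b q)) by field. now apply exp_ln.
Qed.

Lemma log_modulus_partials_norm2 (a b u v : R * R -> R) (q : R * R) :
  0 < a q * a q + b q * b q ->
  log_modulus_x a b u v q * log_modulus_x a b u v q + log_modulus_y a b u v q * log_modulus_y a b u v q
  = (u q * u q + v q * v q) * / (a q * a q + b q * b q).
Proof. intros H. unfold log_modulus_x, log_modulus_y. field. lra. Qed.

(** Each of [k1], [k2] has absolute value at most 1, so each of [s], [t] is counted at most twice.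
    The left side is the l1 norm of [(k1 - i k2) (s + i t)]. *)
Lemma Rabs_rotation_le (k1 k2 s t : R) : k1 * k1 + k2 * k2 = 1 ->
  Rabs (k1 * s + k2 * t) + Rabs (k1 * t - k2 * s) <= 2 * (Rabs s + Rabs t).
Proof.
  intros Hk.
  assert (B : forall x y, x * x + y * y = 1 -> Rabs x <= 1).
  { intros x y E. apply Rabs_le. nra. }
  assert (B1 := B k1 k2 Hk).
  assert (B2 : Rabs k2 <= 1) by (apply (B k2 k1); lra).
  assert (T1 := Rabs_triang (k1 * s) (k2 * t)).
  assert (T2 := Rabs_triang (k1 * t) (- (k2 * s))).
  rewrite Rabs_Ropp in T2. rewrite !Rabs_mult in T1, T2.
  assert (S0 := Rabs_pos s). assert (T0 := Rabs_pos t).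
  unfold Rminus. nra.
Qed.

(** * The map W *)

Section Isometry.

Variables (p : R * R) (d c : R) (a b u v A B phi : R * R -> R).
Let V : R * R -> Prop := ball p d.
Hypothesis (Hd : 0 < d) (Hc : 0 < c).
Hypothesis (Hu : has_partials V u A B) (Hv : has_partials V v (fun q => - B q) A).
Hypothesis (Ha : has_partials V a u (fun q => - v q)) (Hb : has_partials V b v u).
Hypothesis (Ru : forall n, Ck V n u) (Rv : forall n, Ck V n v).
Hypothesis (Hm : forall q, V q -> 0 < a q * a q + b q * b q).
Hypothesis (Huv : forall q, V q -> u q * u q + v q * v q = exp (2 * phi q)).
Hypothesis (Hs : near_scaling V a b c).

Let Phi : R * R -> R := log_modulus a b.
Let P : R * R -> R := log_modulus_x a b u v.
Let Q : R * R -> R := log_modulus_y a b u v.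

Variable (Psi : R * R -> R).
Hypothesis (HPsi : harmonic_conjugate_on V Phi Psi).

Let w1 (q : R * R) : R := exp (Phi q) * cos (Psi q).
Let w2 (q : R * R) : R := exp (Phi q) * sin (Psi q).
Let W (q : R * R) : R * R := (w1 q, w2 q).

Let HV : open V := open_ball_prod p d.

Let HPhi : has_partials V Phi P Q := has_partials_log_modulus V a b u v HV Ha Hb Hm.

Lemma has_partials_conjugate : has_partials V Psi (fun q => - Q q) P.
Proof.
  destruct HPsi as [[Sm _] CR].
  assert (R1 : Ck V 1 Psi) by (intros q Hq; now apply Sm).
  generalize (proj1 (Ck_S_inv _ _ _ R1)). apply has_partials_ext; trivial.
  - intros q Hq. destruct (CR q Hq) as [_ E]. destruct (has_partials_unique V _ _ _ HPhi q Hq). lra.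
  - intros q Hq. destruct (CR q Hq) as [E _]. destruct (has_partials_unique V _ _ _ HPhi q Hq). lra.
Qed.

(** [X + i Y] is the complex derivative [W' = W (P - i Q)]. *)
Let X (q : R * R) : R := w1 q * P q + w2 q * Q q.
Let Y (q : R * R) : R := w2 q * P q - w1 q * Q q.

Lemma has_partials_W : has_partials V w1 X (fun q => - Y q) /\ has_partials V w2 Y X.
Proof.
  destruct (has_partials_polar V Phi Psi P Q HPhi has_partials_conjugate) as [H1 H2].
  split.
  - revert H1. apply has_partials_ext; trivial; intros q Hq; unfold X, Y, w1, w2; ring.
  - revert H2. apply has_partials_ext; trivial; intros q Hq; unfold X, Y, w1, w2; ring.
Qed.

Lemma Ck_W (n : nat) : Ck V n w1 /\ Ck V n w2.
Proof.
  destruct (Ck_log_modulus_partials V a b u v HV Ha Hb Ru Rv Hm n).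
  now apply (Ck_polar V n Phi Psi P Q HV HPhi has_partials_conjugate).
Qed.

Lemma Ck_W_partials (n : nat) : Ck V n X /\ Ck V n Y.
Proof.
  destruct (Ck_log_modulus_partials V a b u v HV Ha Hb Ru Rv Hm n).
  destruct (Ck_W n).
  split; [apply Ck_plus | apply Ck_minus]; trivial; now apply Ck_mult.
Qed.

Lemma W_norm2 (q : R * R) : V q -> w1 q * w1 q + w2 q * w2 q = a q * a q + b q * b q.
Proof.
  intros Hq. rewrite <- (exp_log_modulus a b q (Hm q Hq)).
  assert (T := sin2_cos2 (Psi q)). unfold Rsqr in T. fold Phi. unfold w1, w2.
  replace (_ + _) with (exp (Phi q) * exp (Phi q) *
     (sin (Psi q) * sin (Psi q) + cos (Psi q) * cos (Psi q))) by ring.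
  rewrite T; ring.
Qed.

(** Here [|W'| = |W| |P - i Q|], and [|W| = |a + i b|] cancels the denominator of the logarithmic
    derivative, leaving [|u + i v|]. *)
Lemma W_partials_norm2 (q : R * R) : V q -> X q * X q + Y q * Y q = exp (2 * phi q).
Proof.
  intros Hq. assert (Hmq := Hm q Hq).
  replace (X q * X q + Y q * Y q) with ((w1 q * w1 q + w2 q * w2 q) * (P q * P q + Q q * Q q))
    by (unfold X, Y; ring).
  unfold P, Q. rewrite W_norm2, log_modulus_partials_norm2, Huv by trivial. field. lra.
Qed.

(* Both [W] and [a + i b] have logarithmic derivative [P - i Q], so their quotient is constant. *)
Lemma W_rotation : exists k1 k2, k1 * k1 + k2 * k2 = 1 /\
  forall q, V q -> w1 q = k1 * a q - k2 * b q /\ w2 q = k2 * a q + k1 * b q.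
Proof.
  destruct has_partials_W as [H1 H2].
  assert (I := has_partials_inv V _ _ _ (fun q Hq => Rgt_not_eq _ _ (Hm q Hq))
     (has_partials_norm2 V a b u v Ha Hb)).
  (* [D1] and [D2] differentiate the real and imaginary parts of [W / (a + i b)], written as
     [W (a - i b) / (a^2 + b^2)]. *)
  assert (D1 := has_partials_mult _ _ _ _ _ _ _ (has_partials_plus _ _ _ _ _ _ _
     (has_partials_mult _ _ _ _ _ _ _ H1 Ha) (has_partials_mult _ _ _ _ _ _ _ H2 Hb)) I).
  assert (D2 := has_partials_mult _ _ _ _ _ _ _ (has_partials_plus _ _ _ _ _ _ _
     (has_partials_mult _ _ _ _ _ _ _ H2 Ha)
     (has_partials_opp _ _ _ _ (has_partials_mult _ _ _ _ _ _ _ H1 Hb))) I).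
  assert (Hp : V p) by exact (ball_center p (mkposreal d Hd)).
  assert (E1 := fun Z q Hq => box_constant p d _ _ _ D1 Z p q Hp Hq).
  assert (E2 := fun Z q Hq => box_constant p d _ _ _ D2 Z p q Hp Hq).
  cbv beta in E1, E2.
  exists ((w1 p * a p + w2 p * b p) * / (a p * a p + b p * b p)),
    ((w2 p * a p + - (w1 p * b p)) * / (a p * a p + b p * b p)).
  split.
  - assert (Hmq := Hm p Hp). assert (N := W_norm2 p Hp).
    transitivity ((w1 p * w1 p + w2 p * w2 p) * / (a p * a p + b p * b p)).
    + field. lra.
    + rewrite N. field. lra.
  - intros q Hq.
    rewrite <- (E1) with (q := q), <- (E2) with (q := q); trivial.
    + assert (Hmq := Hm q Hq). split; field; lra.
    + intros z Hz. assert (Hmq := Hm z Hz).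
      unfold X, Y, P, Q, log_modulus_x, log_modulus_y. split; field; lra.
    + intros z Hz. assert (Hmq := Hm z Hz).
      unfold X, Y, P, Q, log_modulus_x, log_modulus_y. split; field; lra.
Qed.

(** Undoing the rotation expresses [a + i b] through [W]; the factor 2 is the l1 cost of that
    rotation. *)
Lemma W_lower_lipschitz (z w : R * R) : V z -> V w ->
  c / 2 * dist1 z w <= 2 * dist1 (W z) (W w).
Proof.
  intros Hz Hw. eapply Rle_trans; [apply (near_scaling_lower_lipschitz V a b c); trivial |].
  destruct W_rotation as (k1 & k2 & Hk & HW).
  assert (E : forall q, V q -> a q = k1 * w1 q + k2 * w2 q /\ b q = k1 * w2 q - k2 * w1 q).
  { intros q Hq. destruct (HW q Hq) as [-> ->]. split.
    - replace (_ + _) with ((k1 * k1 + k2 * k2) * a q) by ring. rewrite Hk; ring.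
    - replace (_ - _) with ((k1 * k1 + k2 * k2) * b q) by ring. rewrite Hk; ring. }
  destruct (E z Hz) as [-> ->], (E w Hw) as [-> ->].
  unfold dist1; simpl.
  eapply Rle_trans; [| apply (Rabs_rotation_le k1 k2 _ _ Hk)].
  right. f_equal; f_equal; ring.
Qed.

(** A target near [W z0] is rotated back, solved for [a + i b] by the contraction, and the solution
    serves for [W]. *)
Lemma open_image_W : open (image W V).
Proof.
  destruct W_rotation as (k1 & k2 & Hk & HW).
  intros w0 [z0 [Hz0 <-]].
  destruct (near_scaling_open V a b c z0 HV Hc Hs Hz0) as (r & Hr & H).
  (* A factor 2 is lost from the square to the l1 norm and another 2 in the rotation. *)
  assert (Hr4 : 0 < r / 4) by lra.
  exists (mkposreal _ Hr4). intros [s t] Hst.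
  apply (proj1 (ball_box _ _ _)) in Hst. simpl in Hst. destruct Hst as [Hs1 Hs2].
  destruct (H (k1 * s + k2 * t, k1 * t - k2 * s)) as (z & Hz & E).
  - unfold dist1; simpl.
    eapply Rle_lt_trans with (2 * (Rabs (s - w1 z0) + Rabs (t - w2 z0))); [| lra].
    eapply Rle_trans; [| apply (Rabs_rotation_le k1 k2 _ _ Hk)].
    destruct (HW z0 Hz0) as [-> ->]. right. f_equal; f_equal.
    + replace (a z0) with ((k1 * k1 + k2 * k2) * a z0) at 1 by (rewrite Hk; ring). ring.
    + replace (b z0) with ((k1 * k1 + k2 * k2) * b z0) at 1 by (rewrite Hk; ring). ring.
  - exists z. split; trivial. injection E as Ea Eb. unfold W.
    destruct (HW z Hz) as [-> ->]. rewrite Ea, Eb.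
    apply injective_projections; simpl.
    + transitivity ((k1 * k1 + k2 * k2) * s); [ring | rewrite Hk; ring].
    + transitivity ((k1 * k1 + k2 * k2) * t); [ring | rewrite Hk; ring].
Qed.

Lemma diffeomorphism_W : diffeomorphism V (image W V) W.
Proof.
  split; [| split].
  - split; intros q Hq n; [exact (proj1 (Ck_W n) q Hq) | exact (proj2 (Ck_W n) q Hq)].
  - intros q Hq. now exists q.
  (* The inverse is chosen pointwise; off the image its value is arbitrary. *)
  - set (G := fun q => epsilon (inhabits (0, 0)) (fun z => V z /\ W z = q)).
    assert (HG : forall q, image W V q -> V (G q) /\ W (G q) = q)
      by (intros q Hq; unfold G; now apply epsilon_spec).
    assert (Inj : forall z w, V z -> V w -> W z = W w -> z = w).
    { intros z w Hz Hw E. assert (D := W_lower_lipschitz z w Hz Hw). rewrite E in D.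
      unfold dist1 in D. rewrite !Rminus_diag, Rabs_R0 in D.
      assert (Z1 := Rabs_pos (fst w - fst z)). assert (Z2 := Rabs_pos (snd w - snd z)).
      assert (Rabs (fst w - fst z) = 0) by nra. assert (Rabs (snd w - snd z) = 0) by nra.
      apply Rabs_eq_0 in H, H0. rewrite (surjective_pairing z), (surjective_pairing w).
      f_equal; lra. }
    assert (HR : forall n, Ck (image W V) n (fun q => fst (G q)) /\ Ck (image W V) n (fun q => snd (G q))).
    (* The Lipschitz constant follows from [c / 2 * dist1 <= 2 * dist1] between source and target,
       the target [dist1] being at most twice the maximum. *)
    { assert (C0 : 0 < 8 / c) by (apply Rdiv_lt_0_compat; lra).
      apply (conformal_inverse_Ck V (image W V) w1 w2 X Y _ _ (8 / c)); trivial.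
      - apply open_image_W.
      - apply has_partials_W.
      - apply has_partials_W.
      - intros z Hz. apply (Ck_continuous V 0); trivial. apply Ck_W_partials.
      - intros z Hz. apply (Ck_continuous V 0); trivial. apply Ck_W_partials.
      - intros z Hz. rewrite W_partials_norm2 by trivial. apply Rgt_not_eq, exp_pos.
      - intros q Hq. rewrite <- surjective_pairing. now apply HG.
      - intros q Hq. rewrite <- surjective_pairing. now apply HG.
      - intros q w Hq Hw. destruct (HG q Hq) as [V1 E1], (HG w Hw) as [V2 E2].
        assert (D := W_lower_lipschitz _ _ V1 V2). rewrite E1, E2 in D. unfold dist1 in D.
        assert (M1 := Rmax_l (Rabs (fst w - fst q)) (Rabs (snd w - snd q))).
        assert (M2 := Rmax_r (Rabs (fst w - fst q)) (Rabs (snd w - snd q))).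
        set (M := Rmax (Rabs (fst w - fst q)) (Rabs (snd w - snd q))) in *.
        assert (Z1 := Rabs_pos (fst (G w) - fst (G q))).
        assert (Z2 := Rabs_pos (snd (G w) - snd (G q))).
        split; apply Rmult_le_reg_l with (c / 2); try lra;
          replace (c / 2 * (8 / c * M)) with (4 * M) by (field; lra); nra.
      - intros n; apply Ck_W_partials.
      - intros n; apply Ck_W_partials. }
    exists G. split; [| split; [| split]].
    + split; intros q Hq n; [exact (proj1 (HR n) q Hq) | exact (proj2 (HR n) q Hq)].
    + intros q Hq. now apply HG.
    + intros q Hq. assert (I : image W V (W q)) by now exists q.
      apply Inj; trivial; now apply HG.
    + intros q Hq. now apply HG.
Qed.

(** The Jacobian matrix has rows [(X, - Y)] and [(Y, X)], so it multiplies inner products by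
    [X^2 + Y^2]. *)
Lemma isometry_W : isometry V (conformal_metric phi) (image W V) g0 W.
Proof.
  split; [apply diffeomorphism_W |].
  intros q Hq x y. destruct has_partials_W as [H1 H2].
  unfold pullback_metric, pushforward.
  change (fun q0 => fst (W q0)) with w1. change (fun q0 => snd (W q0)) with w2.
  destruct (has_partials_unique V _ _ _ H1 q Hq) as [-> ->].
  destruct (has_partials_unique V _ _ _ H2 q Hq) as [-> ->].
  unfold conformal_metric, g0. rewrite <- W_partials_norm2 by trivial. simpl. ring.
Qed.

End Isometry.

Theorem theorem2 (phi : R * R -> R) (hphi : harmonic_on (fun _ : R * R => True) phi)
    (p : R * R) :
  exists (V : R * R -> Prop) (Phi : R * R -> R),
    open V /\ V p /\ simply_connected V /\
    harmonic_on V Phi /\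
    (forall q : R * R, V q -> gradient Phi q <> (0, 0)) /\
    (forall q : R * R, V q ->
       Phi q + ln (metric_length g0 q (gradient Phi q)) = phi q) /\
    (forall Psi : R * R -> R, harmonic_conjugate_on V Phi Psi ->
       let W : R * R -> R * R :=
         fun q => (exp (Phi q) * cos (Psi q), exp (Phi q) * sin (Psi q)) in
       open (image W V) /\
       isometry V (conformal_metric phi) (image W V) g0 W).
Proof.
  destruct (harmonic_primitive phi p hphi)
    as (u & v & A & B & a & b & Hu & Hv & Ha & Hb & Ru & Rv & Huv & a1 & b0 & Hc & v0).
  set (c := u p) in *.
  (* The bounds by [c / 4] serve the contraction; positivity of [a] keeps [a + i b] away from
     zero. *)
  assert (Hloc : locally p (fun q => (Rabs (u q - c) <= c / 4 /\ Rabs (v q) <= c / 4) /\ 0 < a q)).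
  { assert (Near : forall f e, 0 < e -> continuous f p -> locally p (fun q => Rabs (f q - f p) < e)).
    { intros f e He Cf. apply (Cf (fun y => Rabs (y - f p) < e)).
      exists (mkposreal e He). now intros y Hy. }
    repeat apply filter_and.
    - assert (L := Near u (c / 4) ltac:(lra) (Ck_continuous _ _ _ (Ru 0%nat) p I)).
      revert L. apply filter_imp. intros q Hq. now left.
    - assert (L := Near v (c / 4) ltac:(lra) (Ck_continuous _ _ _ (Rv 0%nat) p I)).
      revert L. apply filter_imp. intros q Hq. rewrite v0, Rminus_0_r in Hq. now left.
    - assert (Ca : continuous a p).
      { apply (has_partials_continuous (fun _ => True) a u (fun q => - v q)); trivial.
        - apply open_true.
        - exact (Ck_continuous _ _ _ (Ru 0%nat) p I). }
      assert (L := Near a 1 ltac:(lra) Ca).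
      revert L. apply filter_imp. intros q Hq. rewrite a1 in Hq. apply Rabs_lt_between' in Hq. lra. }
  destruct Hloc as [[d Hd] Hball]. simpl in Hball.
  assert (HV : open (fun q : R * R => ball p d q)) by apply open_ball_prod.
  apply (has_partials_subset (ball p d)) in Hu, Hv, Ha, Hb; try easy.
  assert (Ru' : forall n, Ck (ball p d) n u) by (intros n q _; now apply Ru).
  assert (Rv' : forall n, Ck (ball p d) n v) by (intros n q _; now apply Rv).
  assert (Hm : forall q, ball p d q -> 0 < a q * a q + b q * b q).
  { intros q Hq. destruct (Hball q Hq) as [_ Hpos]. nra. }
  assert (Hs : near_scaling (ball p d) a b c).
  { apply (box_near_scaling p d c a b u v); trivial. intros q Hq. now apply Hball. }
  assert (HPhi := has_partials_log_modulus _ _ _ _ _ HV Ha Hb Hm).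
  assert (HN : forall q, ball p d q ->
    dx (log_modulus a b) q * dx (log_modulus a b) q + dy (log_modulus a b) q * dy (log_modulus a b) q
    = exp (2 * phi q) * / (a q * a q + b q * b q)).
  { intros q Hq. destruct (has_partials_unique _ _ _ _ HPhi q Hq) as [-> ->].
    rewrite log_modulus_partials_norm2 by now apply Hm. now rewrite Huv. }
  exists (ball p d), (log_modulus a b).
  split; [exact HV |]. split; [apply (ball_center p (mkposreal d Hd)) |].
  split; [apply ball_simply_connected |].
  split; [now apply (harmonic_log_modulus _ a b u v A B) |].
  split; [| split].
  - intros q Hq E. specialize (HN q Hq). unfold gradient in E. injection E as E1 E2.
    rewrite E1, E2 in HN.
    assert (0 < exp (2 * phi q) * / (a q * a q + b q * b q)).
    { apply Rmult_lt_0_compat; [apply exp_pos | now apply Rinv_0_lt_compat, Hm]. }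
    lra.
  - intros q Hq. unfold metric_length, g0, gradient; simpl. rewrite HN by trivial.
    rewrite <- (exp_log_modulus a b q (Hm q Hq)).
    set (e := exp (log_modulus a b q)). assert (He : 0 < e) by apply exp_pos.
    (* Since [e] is [|a + i b|], the squared gradient is a perfect square and its root is
       [exp (phi - Phi)]. *)
    replace (exp (2 * phi q) * / (e * e)) with (Rsqr (exp (phi q) / e)).
    + rewrite sqrt_Rsqr by (left; apply Rdiv_lt_0_compat; [apply exp_pos | trivial]).
      rewrite ln_div by (trivial; apply exp_pos). unfold e; rewrite !ln_exp. ring.
    + replace (2 * phi q) with (phi q + phi q) by ring. rewrite exp_plus. unfold Rsqr. field. lra.
  - intros Psi HPsi W. split.
    + now apply (open_image_W p d c a b u v).
    + now apply (isometry_W p d c a b u v phi).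
Qed.
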